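(* Let $0<s\le1$ and let $f(z)=z+\sum_{n=2}^{\infty}a_nz^n$ belong to the class $\mathcal{ST}_{hpl}(s)$. Then $$|a_n|\le\frac{(s)_{n-1}}{(n-1)!}\qquad(n=2,3,4,\dots).$$
   Context: Let $\mathbb{D}=\{z\in\mathbb{C}:|z|<1\}$, and let $\mathcal{S}$ be the class of functions $f(z)=z+\sum_{n\ge2}a_nz^n$ that are holomorphic and univalent in $\mathbb{D}$. For $0<s\le1$ put $\mathfrak{q}_s(z)=(1-z)^{-s}=e^{-s\ln(1-z)}$, $z\in\mathbb{D}$, with the branch of the logarithm such that $\mathfrak{q}_s(0)=1$. For holomorphic functions $p,F$ in $\mathbb{D}$, $p\prec F$ (subordination) means that there is a holomorphic $\omega:\mathbb{D}\to\mathbb{D}$ with $\omega(0)=0$ and $p(z)=F(\omega(z))$ for all $z\in\mathbb{D}$. The class $\mathcal{ST}_{hpl}(s)$ consists of all $f\in\mathcal{S}$ with $\frac{zf'(z)}{f(z)}\prec\mathfrak{q}_s(z)$ in $\mathbb{D}$. The Pochhammer symbol is $(a)_n=\Gamma(a+n)/\Gamma(a)=a(a+1)\cdots(a+n-1)$. *)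

(* Defs.v *)
From Stdlib Require Export Reals.
From Coquelicot Require Export Coquelicot.
From Stdlib Require Import Lra.
Open Scope R_scope.

Definition unit_disk (z : C) : Prop := Cmod z < 1.

(* Functions on the disk are total functions [C -> C] whose values outside
   the disk are irrelevant.  The disk is open, so the (two-sided, complex)
   derivative at a point of the disk only depends on values in the disk. *)
Definition holomorphic_on_disk (f : C -> C) : Prop :=
  forall z : C, unit_disk z -> ex_derive (K := C_AbsRing) (V := C_NormedModule) f z.

Definition univalent_on_disk (f : C -> C) : Prop :=
  forall z w : C, unit_disk z -> unit_disk w -> f z = f w -> z = w.

(* f(z) = z + a_2 z^2 + a_3 z^3 + ... on the disk. *)
Definition normalized_expansion (a : nat -> C) (f : C -> C) : Prop :=
  a 0%nat = RtoC 0 /\ a 1%nat = RtoC 1 /\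
  forall z : C, unit_disk z ->
    is_pseries (K := C_AbsRing) (V := C_NormedModule) a z (f z).

Definition class_S (f : C -> C) : Prop :=
  holomorphic_on_disk f /\ univalent_on_disk f /\
  exists a : nat -> C, normalized_expansion a f.

Definition Cexp (z : C) : C := (exp (Re z) * cos (Im z), exp (Re z) * sin (Im z)).

(* Principal logarithm, meaningful only for [0 < Re w]; it is used at
   [w = 1 - z] with [Cmod z < 1]. *)
Definition Clog (w : C) : C := (ln (Cmod w), atan (Im w / Re w)).

Definition q_hpl (s : R) (z : C) : C := Cexp (- (RtoC s * Clog (RtoC 1 - z)))%C.

Definition subordinate (p F : C -> C) : Prop :=
  exists omega : C -> C,
    holomorphic_on_disk omega /\
    (forall z : C, unit_disk z -> unit_disk (omega z)) /\
    omega (RtoC 0) = RtoC 0 /\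
    forall z : C, unit_disk z -> p z = F (omega z).

(* z f'(z) / f(z), with its removable singularity at 0 filled in: for f in
   [class_S] the value there is f'(0) = 1. *)
Definition starlike_quotient (f : C -> C) (z : C) : C :=
  if Ceq_dec z (RtoC 0) then RtoC 1 else (z * C_derive f z / f z)%C.

Definition class_ST_hpl (s : R) (f : C -> C) : Prop :=
  class_S f /\ subordinate (starlike_quotient f) (q_hpl s).

Fixpoint pochhammer (x : R) (n : nat) : R :=
  match n with
  | O => 1
  | S m => pochhammer x m * (x + INR m)
  end.

Lemma Cexp_plus (z w : C) : Cexp (z + w) = (Cexp z * Cexp w)%C.
Proof.
destruct z as [x y], w as [u v]; unfold Cexp, Cmult, Cplus; simpl.
rewrite exp_plus, cos_plus, sin_plus; f_equal; ring.
Qed.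

Lemma Cexp_Clog (w : C) : 0 < Re w -> Cexp (Clog w) = w.
Proof.
destruct w as [x y]; unfold Cexp, Clog, Cmod; simpl; intros Hx.
assert (Hs : 0 < x * (x * 1) + y * (y * 1)) by nra.
rewrite exp_ln by now apply sqrt_lt_R0.
assert (E : sqrt (x * (x * 1) + y * (y * 1)) = x * sqrt (1 + (y / x)²)).
{ rewrite <- (sqrt_square x) at 3 by lra.
  rewrite <- sqrt_mult; [| nra | pose proof (Rle_0_sqr (y / x)); lra].
  f_equal; unfold Rsqr; field; lra. }
assert (Hr : 0 < sqrt (1 + (y / x)²)).
{ apply sqrt_lt_R0; pose proof (Rle_0_sqr (y / x)); lra. }
rewrite cos_atan, sin_atan, E; f_equal; field; lra.
Qed.

Lemma q_hpl_0 (s : R) : q_hpl s (RtoC 0) = RtoC 1.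
Proof.
unfold q_hpl.
replace (RtoC 1 - RtoC 0)%C with (RtoC 1) by ring.
assert (E : Clog (RtoC 1) = RtoC 0).
{ unfold Clog; rewrite Cmod_1, ln_1; simpl.
  now replace (0 / 1) with 0 by field; rewrite atan_0. }
rewrite E; replace (- (RtoC s * RtoC 0))%C with (RtoC 0) by ring.
unfold Cexp; simpl; rewrite exp_0, cos_0, sin_0; unfold RtoC; f_equal; ring.
Qed.

(* Main.v *)
Require Import Defs.
From Stdlib Require Import Reals Factorial.
From Coquelicot Require Import Coquelicot.
From Stdlib Require Import Lra Lia.
Open Scope R_scope.

(** Let p(z) = z f'(z) / f(z) = 1 + p_1 z + p_2 z^2 + ...  Everything rests on
    the bound |p_k| <= s for k >= 1.  Comparing coefficients in p f = z f' then
    gives (n - 1) |a_n| <= s (|a_1| + ... + |a_(n-1)|), and the numbers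
    (s)_(n-1) / (n-1)! satisfy this recursion with equality.

    The bound on p_k is Rogosinski's inequality for the convex function
    q_s(z) = (1 - z)^(-s), obtained here by a duality argument.  For |zeta| < 1
    and |w| < 1,
      Re ((1 - zeta)^s conj(1 - zeta) q_s(w)) >= |1 - zeta|^2 / 2,
    which in polar coordinates is the concavity of ln cos ([kernel_lower_bound]).
    Fix k >= 1 and |c| = 1 and put zeta = conj(c) z^k.  On the circle |z| = r one
    has conj(1 - zeta) = 1 - r^(2k) / zeta, so that, taking q_s(w) = p(z), the
    left side is the real part of a function of z that is holomorphic in the
    punctured disk.  Its mean over the circle is 1 - r^(2k) (Re (c p_k) - s), and
    the mean of the right side is (1 + r^(2k)) / 2.  Letting r tend to 1 yields
    Re (c p_k) <= s ([unimodular_coefficient_le]).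

    Two facts about the mean of Re K over |z| = r are used, for K holomorphic
    with continuous derivative in the punctured disk: it does not depend on r
    ([mean_radius]), and it is the real part of the limit of K at 0 when that
    limit exists ([mean_tends0]).  Thus every coefficient is read off from the
    behaviour at the origin, as the mean of c z^(-k) p.  The
    continuity of p' holds because f is a power series, which can be
    differentiated term by term ([disk_pseries_derive]). *)

(** * Complex differentiation *)

(** The uniform structure given by the modulus.  [C] carries as its default one
    that of the product R x R; the modulus is the structure that [is_derive]
    uses on the source, and sums, products and compositions of functions from
    [C] to [C] stay within it. *)
Notation CU := (AbsRing_UniformSpace C_AbsRing) (only parsing).
Notation Ccontinuous := (@continuous CU CU) (only parsing).

(** Complex derivative in Caratheodory's form: the difference quotient extends
    continuously.  The rules for sums, products, inverses and compositions
    become algebraic identities between the functions [phi]. *)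
Definition Cderiv (f : C -> C) (z l : C) : Prop :=
  exists phi : C -> C,
    Ccontinuous phi z /\ phi z = l /\
    @locally CU z (fun w : C => f w = (f z + (w - z) * phi w)%C).

Lemma Cminus_neq0 (w z : C) : w <> z -> (w - z)%C <> RtoC 0.
Proof.
intros n E; apply n; replace w with (w - z + z)%C by ring; rewrite E; ring.
Qed.

Lemma Cball (x y : C) (e : R) : @ball CU x e y = (Cmod (y - x)%C < e).
Proof. reflexivity. Qed.

Lemma Ccontinuous_eps f z :
  Ccontinuous f z <->
  forall eps : posreal, @locally CU z (fun w : C => Cmod (f w - f z)%C < eps).
Proof. exact (@filterlim_locally C CU (@locally CU z) _ f (f z)). Qed.

Lemma Ccontinuous_plus f g z :
  Ccontinuous f z -> Ccontinuous g z -> Ccontinuous (fun w => f w + g w)%C z.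
Proof.
intros Hf Hg.
exact (@continuous_plus CU C_AbsRing (AbsRing_NormedModule C_AbsRing) f g z Hf Hg).
Qed.

Lemma Ccontinuous_mult f g z :
  Ccontinuous f z -> Ccontinuous g z -> Ccontinuous (fun w => f w * g w)%C z.
Proof.
intros Hf Hg.
exact (@continuous_mult CU C_AbsRing f g z Hf Hg).
Qed.

Lemma Ccontinuous_const c z : Ccontinuous (fun _ => c) z.
Proof. exact (@continuous_const CU CU c z). Qed.

Lemma Ccontinuous_id z : Ccontinuous (fun w => w) z.
Proof. exact (@continuous_id CU z). Qed.

Lemma Ccontinuous_comp f g z :
  Ccontinuous f z -> Ccontinuous g (f z) -> Ccontinuous (fun w => g (f w)) z.
Proof. exact (@continuous_comp CU CU CU f g z). Qed.

Lemma Ccontinuous_ext_loc f g z :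
  @locally CU z (fun w : C => g w = f w) -> Ccontinuous g z -> Ccontinuous f z.
Proof. exact (@continuous_ext_loc CU CU f g z). Qed.

Lemma Ccontinuous_inv z : z <> RtoC 0 -> Ccontinuous Cinv z.
Proof.
intros Hz.
apply Cmod_gt_0 in Hz.
apply Ccontinuous_eps; intros eps.
assert (Hd : 0 < Rmin (Cmod z / 2) (eps * (Cmod z * (Cmod z / 2)))).
{ apply Rmin_glb_lt; [lra|]. destruct eps as [e He]; simpl.
  repeat apply Rmult_lt_0_compat; lra. }
exists (mkposreal _ Hd); intros w Hw.
rewrite Cball in Hw; simpl in Hw.
assert (H1 := Rlt_le_trans _ _ _ Hw (Rmin_l _ _)).
assert (H2 := Rlt_le_trans _ _ _ Hw (Rmin_r _ _)).
assert (Hwl : Cmod z / 2 < Cmod w).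
{ pose proof (Cmod_triangle w (- (w - z))%C) as T.
  replace (w + - (w - z))%C with z in T by ring.
  rewrite Cmod_opp in T; lra. }
assert (Hw0 : w <> RtoC 0) by (apply Cmod_gt_0; lra).
assert (Hz0 : z <> RtoC 0) by (apply Cmod_gt_0; lra).
replace (/ w - / z)%C with (- (w - z) / (w * z))%C by (field; now split).
assert (Hwz : (w * z)%C <> RtoC 0) by now apply Cmult_neq_0.
rewrite Cmod_div, Cmod_opp, Cmod_mult by exact Hwz.
apply (Rmult_lt_reg_r (Cmod w * Cmod z)); [nra|].
unfold Rdiv; rewrite Rmult_assoc, Rinv_l by nra.
rewrite Rmult_1_r.
apply Rlt_le_trans with (1 := H2).
destruct eps as [e He]; simpl.
apply Rmult_le_compat_l; nra.
Qed.

Lemma Ccontinuous_neq0 f z :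
  Ccontinuous f z -> f z <> RtoC 0 -> @locally CU z (fun w : C => f w <> RtoC 0).
Proof.
intros Hf Hz; apply Cmod_gt_0 in Hz.
assert (H := proj1 (Ccontinuous_eps f z) Hf (mkposreal _ Hz)).
apply filter_imp with (2 := H); intros w Hw E.
rewrite E in Hw; simpl in Hw.
replace (0 - f z)%C with (- f z)%C in Hw by ring.
rewrite Cmod_opp in Hw; lra.
Qed.

Lemma Cderiv_continuous f z l : Cderiv f z l -> Ccontinuous f z.
Proof.
intros (phi & Hc & _ & He).
apply (Ccontinuous_ext_loc f (fun w => f z + (w - z) * phi w)%C).
{ apply filter_imp with (2 := He); now intros w ->. }
apply Ccontinuous_plus; [apply Ccontinuous_const|].
apply Ccontinuous_mult; [|exact Hc].
apply (Ccontinuous_plus (fun w : C => w) (fun _ : C => - z)%C);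
  [apply Ccontinuous_id|apply Ccontinuous_const].
Qed.

Lemma Cderiv_of_eps f z l :
  (forall eps : posreal, exists del : posreal, forall w, Cmod (w - z)%C < del ->
     Cmod (f w - f z - (w - z) * l)%C <= eps * Cmod (w - z)%C) ->
  Cderiv f z l.
Proof.
intros H.
exists (fun w => if Ceq_dec w z then l else ((f w - f z) / (w - z))%C).
destruct (Ceq_dec z z) as [_|n]; [|now destruct n].
split; [|split; [reflexivity|]].
- apply Ccontinuous_eps; intros eps.
  destruct (Ceq_dec z z) as [_|n]; [|now destruct n].
  assert (He : 0 < eps / 2) by (destruct eps; simpl; lra).
  destruct (H (mkposreal _ He)) as [d Hd].
  exists d; intros w Hw; rewrite Cball in Hw.
  destruct (Ceq_dec w z) as [E|n].
  + replace (l - l)%C with (RtoC 0) by ring; rewrite Cmod_0; apply eps.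
  + specialize (Hd w Hw); simpl in Hd.
    assert (n0 : (w - z)%C <> RtoC 0) by now apply Cminus_neq0.
    replace ((f w - f z) / (w - z) - l)%C with ((f w - f z - (w - z) * l) / (w - z))%C
      by now field.
    rewrite Cmod_div by exact n0.
    apply Cmod_gt_0 in n0.
    apply (Rmult_lt_reg_r (Cmod (w - z)%C)); [exact n0|].
    unfold Rdiv; rewrite Rmult_assoc, Rinv_l by lra.
    destruct eps as [e e0]; simpl in *; nra.
- apply filter_forall; intros w.
  destruct (Ceq_dec w z) as [->|n]; [ring|].
  field; now apply Cminus_neq0.
Qed.

Lemma Cderiv_eps f z l (eps : posreal) :
  Cderiv f z l ->
  @locally CU z (fun w : C => Cmod (f w - f z - (w - z) * l)%C <= eps * Cmod (w - z)%C).
Proof.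
intros (phi & Hc & <- & He).
assert (H := proj1 (Ccontinuous_eps phi z) Hc eps).
apply filter_imp with (2 := filter_and _ _ He H); intros w [E B].
rewrite E.
replace (f z + (w - z) * phi w - f z - (w - z) * phi z)%C
  with ((phi w - phi z) * (w - z))%C by ring.
rewrite Cmod_mult; pose proof (Cmod_ge_0 (w - z)%C).
apply Rmult_le_compat_r; lra.
Qed.

Lemma Cderiv_is_derive f z l :
  Cderiv f z l -> is_derive (K := C_AbsRing) (V := C_NormedModule) f z l.
Proof.
intros H; split; [apply (is_linear_scal_l (V := C_NormedModule))|].
intros x Hx eps.
rewrite <- (is_filter_lim_locally_unique (V := AbsRing_NormedModule C_AbsRing) z x Hx).
exact (Cderiv_eps f z l eps H).
Qed.

Lemma Clocally_forall (P : C -> Prop) (z : C) : (forall w : C, P w) -> @locally CU z P.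
Proof. exact (@filter_forall C (@locally CU z) _ P). Qed.

Lemma Cderiv_const c z : Cderiv (fun _ => c) z 0.
Proof.
exists (fun _ => RtoC 0); split; [apply Ccontinuous_const|split; [reflexivity|]].
apply Clocally_forall; intros w; ring.
Qed.

Lemma Cderiv_id z : Cderiv (fun w => w) z 1.
Proof.
exists (fun _ => RtoC 1); split; [apply Ccontinuous_const|split; [reflexivity|]].
apply Clocally_forall; intros w; ring.
Qed.

Lemma Cderiv_plus f g z l m :
  Cderiv f z l -> Cderiv g z m -> Cderiv (fun w => f w + g w)%C z (l + m)%C.
Proof.
intros (phi & Hc & <- & He) (psi & Hd & <- & Hf).
exists (fun w => phi w + psi w)%C; split; [now apply Ccontinuous_plus|split; [reflexivity|]].
apply filter_imp with (2 := filter_and _ _ He Hf); intros w [-> ->]; ring.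
Qed.

Lemma Cderiv_mult f g z l m :
  Cderiv f z l -> Cderiv g z m -> Cderiv (fun w => f w * g w)%C z (l * g z + f z * m)%C.
Proof.
intros Hl Hm; assert (Hg := Cderiv_continuous _ _ _ Hm).
destruct Hl as (phi & Hc & <- & He); destruct Hm as (psi & Hd & <- & Hf).
exists (fun w => phi w * g w + f z * psi w)%C; split; [|split; [reflexivity|]].
- apply Ccontinuous_plus; apply Ccontinuous_mult; trivial; apply Ccontinuous_const.
- apply filter_imp with (2 := filter_and _ _ He Hf); intros w [-> ->]; ring.
Qed.

Lemma Cderiv_inv f z l :
  Cderiv f z l -> f z <> RtoC 0 -> Cderiv (fun w => / f w)%C z (- l / (f z * f z))%C.
Proof.
intros Hl Hz; assert (Hg := Cderiv_continuous _ _ _ Hl).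
assert (Hn := Ccontinuous_neq0 f z Hg Hz).
destruct Hl as (phi & Hc & <- & He).
exists (fun w => (- (1)) * phi w * (/ f w * / f z))%C; split; [|split].
- apply Ccontinuous_mult; [apply Ccontinuous_mult; trivial; apply Ccontinuous_const|].
  apply Ccontinuous_mult; [|apply Ccontinuous_const].
  apply (Ccontinuous_comp f Cinv); trivial; now apply Ccontinuous_inv.
- now field.
- apply filter_imp with (2 := filter_and _ _ He Hn); intros w [E n].
  assert (E2 : ((w - z) * phi w = f w - f z)%C) by (rewrite E; ring).
  replace ((w - z) * (- (1) * phi w * (/ f w * / f z)))%C
    with (- ((w - z) * phi w) * (/ f w * / f z))%C by ring.
  rewrite E2; now field.
Qed.

Lemma Cderiv_comp f g z l m :
  Cderiv f z l -> Cderiv g (f z) m -> Cderiv (fun w => g (f w)) z (l * m)%C.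
Proof.
intros Hl Hm; assert (Hf := Cderiv_continuous _ _ _ Hl).
destruct Hl as (phi & Hc & <- & He); destruct Hm as (psi & Hd & <- & Hg).
exists (fun w => phi w * psi (f w))%C; split; [|split; [reflexivity|]].
- apply Ccontinuous_mult; trivial; now apply (Ccontinuous_comp f psi).
- apply Hf in Hg.
  apply filter_imp with (2 := filter_and _ _ He Hg); intros w [E1 E2].
  rewrite E2.
  assert (E3 : ((w - z) * phi w = f w - f z)%C) by (rewrite E1; ring).
  replace ((w - z) * (phi w * psi (f w)))%C with (((w - z) * phi w) * psi (f w))%C by ring.
  now rewrite E3.
Qed.

(** * Power series on the disk *)

Notation Cis_series := (@is_series C_AbsRing C_NormedModule) (only parsing).

Definition disk_pseries (b : nat -> C) (h : C -> C) : Prop :=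
  forall z : C, unit_disk z ->
    is_pseries (K := C_AbsRing) (V := C_NormedModule) b z (h z).

Lemma Cpow_n (z : C) (n : nat) : @pow_n C_AbsRing z n = (z ^ n)%C.
Proof. induction n as [|n IH]; simpl; [reflexivity|now rewrite IH]. Qed.

Lemma disk_pseries_series (b : nat -> C) (h : C -> C) (z : C) :
  disk_pseries b h -> unit_disk z -> Cis_series (fun n => b n * z ^ n)%C (h z).
Proof.
intros H Hz; generalize (H z Hz); apply is_series_ext; intros n.
rewrite Cpow_n; apply Cmult_comm.
Qed.

Lemma Cis_series_norm_le (u : nat -> C) (v : nat -> R) (l : C) (m : R) :
  Cis_series u l -> is_series v m -> (forall n, Cmod (u n) <= v n) -> Cmod l <= m.
Proof.
intros Hu Hv H.
assert (L : is_lim_seq (fun n => Cmod (sum_n u n)) (Cmod l)).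
{ unfold is_lim_seq; simpl.
  apply (filterlim_comp _ _ _ (sum_n u) Cmod _ _ _ Hu).
  exact (filterlim_norm (V := C_NormedModule) l). }
apply (is_lim_seq_le _ (sum_n v) (Cmod l) m) in L; [exact L| |exact Hv].
intros n; unfold sum_n.
apply Rle_trans with (1 := norm_sum_n_m (V := C_NormedModule) u 0 n).
apply sum_n_m_le; intros k; apply H.
Qed.

Lemma Cis_series_term_bounded (u : nat -> C) (l : C) :
  Cis_series u l -> exists M, forall n, Cmod (u n) <= M.
Proof.
intros Hu.
destruct (Cauchy_ex_series (V := C_CompleteNormedModule) u (ex_intro _ l Hu) (mkposreal 1 Rlt_0_1))
  as [N HN].
assert (B : exists M, forall n, (n < N)%nat -> Cmod (u n) <= M).
{ clear; induction N as [|N [M HM]].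
  - exists 0; intros n Hn; lia.
  - exists (Rmax M (Cmod (u N))); intros n Hn.
    destruct (Nat.eq_dec n N) as [->|]; [apply Rmax_r|].
    apply Rle_trans with (2 := Rmax_l _ _), HM; lia. }
destruct B as [M HM]; exists (Rmax M 1); intros n.
destruct (Nat.lt_ge_cases n N) as [h|h].
- apply Rle_trans with (2 := Rmax_l _ _); auto.
- apply Rle_trans with (2 := Rmax_r _ _).
  generalize (HN n n h h); rewrite sum_n_n; simpl; intros h2; apply Rlt_le, h2.
Qed.

(** The terms of the series at a real point r < 1 are bounded, which is enough
    for the radius of convergence of the moduli; the real theory of power series
    then supplies all absolute convergence. *)
Lemma disk_pseries_CV_radius (b : nat -> C) (h : C -> C) :
  disk_pseries b h -> Rbar_le 1 (CV_radius (fun n => Cmod (b n))).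
Proof.
intros H.
destruct (CV_radius_bounded (fun n => Cmod (b n))) as [Hub _].
set (R0 := CV_radius _) in *.
assert (K : forall r, 0 <= r < 1 -> Rbar_le r R0).
{ intros r Hr; apply Hub.
  destruct (Cis_series_term_bounded _ _ (disk_pseries_series b h (RtoC r) H
    ltac:(unfold unit_disk; rewrite Cmod_R, Rabs_pos_eq; lra))) as [M HM].
  exists M; intros n; specialize (HM n).
  rewrite Cmod_mult, Cmod_pow, Cmod_R, (Rabs_pos_eq r) in HM by lra.
  rewrite Rabs_pos_eq; [exact HM|].
  apply Rmult_le_pos; [apply Cmod_ge_0|apply pow_le; lra]. }
destruct R0 as [x| |]; simpl in *; trivial.
- destruct (Rle_lt_dec 1 x) as [h1|h1]; trivial.
  pose proof (K 0 ltac:(lra)).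
  pose proof (K ((1 + x) / 2) ltac:(lra)); lra.
- apply (K 0); lra.
Qed.

(** By induction on the exponent: multiplying the remainder for exponent n by w
    leaves the extra term n z^(n-1) (w - z)^2.  The constant is written so that,
    after multiplication by |b_(m+2)|, it is the m-th term of the second
    derivative of the series of the |b_n|. *)
Lemma Cpow_taylor2 (z w : C) (rho : R) (m : nat) :
  Cmod z <= rho -> Cmod w <= rho ->
  Cmod (w ^ (S (S m)) - z ^ (S (S m)) - INR (S (S m)) * z ^ (S m) * (w - z))%C
    <= INR (S (S m)) * (INR (S m) * rho ^ m) * Cmod (w - z)%C ^ 2.
Proof.
intros Hz Hw; pose proof (Cmod_ge_0 z) as Z0.
induction m as [|m IH].
- replace (w ^ 2 - z ^ 2 - INR 2 * z ^ 1 * (w - z))%C with ((w - z) * (w - z))%C.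
  2:{ replace (RtoC (INR 2)) with (1 + 1)%C; [simpl; ring|].
      unfold RtoC, Cplus; simpl; f_equal; ring. }
  rewrite Cmod_mult; simpl; pose proof (Cmod_ge_0 (w - z)%C); nra.
- set (n := S m) in *; rewrite (S_INR (S n)).
  replace (w ^ S (S n) - z ^ S (S n) - RtoC (INR (S n) + 1) * z ^ S n * (w - z))%C
    with (w * (w ^ S n - z ^ S n - INR (S n) * z ^ n * (w - z))
          + INR (S n) * z ^ n * ((w - z) * (w - z)))%C
    by (rewrite RtoC_plus; simpl; ring).
  apply Rle_trans with (1 := Cmod_triangle _ _).
  rewrite !Cmod_mult, Cmod_pow, Cmod_R, (Rabs_pos_eq (INR (S n))) by apply pos_INR.
  apply Rle_trans with (rho * (INR (S n) * (INR n * rho ^ m) * Cmod (w - z) ^ 2)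
     + INR (S n) * rho ^ n * (Cmod (w - z) * Cmod (w - z))).
  + apply Rplus_le_compat.
    * apply Rmult_le_compat; trivial; apply Cmod_ge_0.
    * apply Rmult_le_compat_r; [apply Rmult_le_pos; apply Cmod_ge_0|].
      apply Rmult_le_compat_l; [apply pos_INR|].
      apply pow_incr; lra.
  + replace (INR (S n) + 1) with (INR (S (S n))) by now rewrite !S_INR.
    replace (rho ^ n) with (rho * rho ^ m) by reflexivity.
    rewrite !S_INR.
    assert (0 <= rho ^ m) by (apply pow_le; lra).
    pose proof (pos_INR n); pose proof (pow2_ge_0 (Cmod (w - z))).
    set (d := Cmod (w - z) ^ 2) in *.
    replace (Cmod (w - z) * Cmod (w - z)) with d by (unfold d; ring).
    set (N := INR n) in *; set (p := rho ^ m) in *.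
    assert (0 <= rho * p * d) by (apply Rmult_le_pos; [apply Rmult_le_pos|]; lra).
    apply Rminus_le.
    match goal with |- ?a <= 0 => replace a with (- ((N + 1) * (rho * p * d))) by ring end.
    assert (0 <= (N + 1) * (rho * p * d)) by (apply Rmult_le_pos; lra); lra.
Qed.

Definition Cderived (b : nat -> C) (n : nat) : C := (INR (S n) * b (S n))%C.

Lemma Cis_series_tail (u : nat -> C) (l : C) :
  Cis_series u l -> Cis_series (fun n => u (S n)) (l - u 0%nat)%C.
Proof.
intros H.
apply (is_series_incr_1 (V := C_NormedModule)).
match goal with |- is_series _ ?a => replace a with l; [exact H|] end.
change (l = (l - u O) + u O)%C; ring.
Qed.

(** Term by term differentiation.  The second-order remainders of the monomials
    ([Cpow_taylor2]) sum to at most a constant times |w - z|^2, the constant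
    being the value at some rho < 1 of the twice differentiated series of the
    moduli. *)
Lemma disk_pseries_derive (b : nat -> C) (h : C -> C) :
  disk_pseries b h ->
  disk_pseries (Cderived b) (C_derive h) /\ forall z, unit_disk z -> Cderiv h z (C_derive h z).
Proof.
intros H.
enough (E : forall z, unit_disk z -> exists l,
  is_pseries (K := C_AbsRing) (V := C_NormedModule) (Cderived b) z l /\ Cderiv h z l).
{ split; intros z Hz; destruct (E z Hz) as (l & Hl & Hd);
    now rewrite (is_C_derive_unique h z l (Cderiv_is_derive _ _ _ Hd)). }
assert (R1 := disk_pseries_CV_radius b h H).
set (nb := fun n => Cmod (b n)) in *.
intros z Hz.
assert (E1 : exists l, is_pseries (K := C_AbsRing) (V := C_NormedModule) (Cderived b) z l).
{  apply (ex_series_le (V := C_CompleteNormedModule)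
    (fun n => scal (@pow_n C_AbsRing z n) (Cderived b n))
    (fun n => Rabs (PS_derive nb n * Cmod z ^ n))).
  - intros n; apply Req_le; rewrite Cpow_n.
    change (Cmod (z ^ n * Cderived b n)%C = Rabs (PS_derive nb n * Cmod z ^ n)).
    unfold Cderived, PS_derive, nb.
    rewrite !Cmod_mult, Cmod_pow, Cmod_R, !Rabs_mult, (Rabs_pos_eq (Cmod _)),
      (Rabs_pos_eq (_ ^ _)); [ring|apply pow_le|]; apply Cmod_ge_0.
  - apply CV_disk_inside; rewrite CV_radius_derive, Rabs_pos_eq by apply Cmod_ge_0.
    apply Rbar_lt_le_trans with (2 := R1); exact Hz. }
destruct E1 as [l1 Hl1]; exists l1; split; [exact Hl1|].
assert (S1 : Cis_series (fun n => Cderived b n * z ^ n)%C l1).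
{ generalize Hl1; apply is_series_ext; intros n.
  rewrite Cpow_n; apply Cmult_comm. }
apply Cderiv_of_eps; intros eps.
unfold unit_disk in Hz.
set (rho := (1 + Cmod z) / 2).
assert (X : ex_series (fun m => PS_derive (PS_derive nb) m * rho ^ m)).
{ apply ex_series_Rabs, CV_disk_inside; rewrite !CV_radius_derive.
  apply Rbar_lt_le_trans with (2 := R1).
  pose proof (Cmod_ge_0 z).
  rewrite Rabs_pos_eq; unfold rho; simpl; lra. }
destruct X as [B HB].
assert (B0 : 0 <= B).
{ apply (is_lim_seq_le (fun _ => 0) _ 0 B) with (3 := HB); [|apply is_lim_seq_const].
  intros n; rewrite sum_n_Reals; apply cond_pos_sum; intros k.
  unfold PS_derive, nb, rho; pose proof (Cmod_ge_0 z).
  repeat apply Rmult_le_pos; try apply pos_INR; try apply Cmod_ge_0; apply pow_le; lra. }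
(* The first bound keeps w within radius rho, the second makes the quadratic
   remainder at most eps |w - z|; B + 1 avoids dividing by zero. *)
assert (Hd : 0 < Rmin (rho - Cmod z) (eps / (B + 1))).
{ apply Rmin_glb_lt; [unfold rho; lra|].
  apply Rdiv_lt_0_compat; [apply eps|lra]. }
exists (mkposreal _ Hd); simpl; intros w Hw.
assert (W1 := Rlt_le_trans _ _ _ Hw (Rmin_l _ _)).
assert (W2 := Rlt_le_trans _ _ _ Hw (Rmin_r _ _)).
assert (Wr : Cmod w <= rho).
{ pose proof (Cmod_triangle z (w - z)%C) as T.
  replace (z + (w - z))%C with w in T by ring; lra. }
assert (Hwd : unit_disk w) by (unfold unit_disk, rho in *; lra).
pose proof (Cis_series_tail _ _ (Cis_series_tail _ _ (disk_pseries_series b h w H Hwd))) as A1.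
pose proof (Cis_series_tail _ _ (Cis_series_tail _ _ (disk_pseries_series b h z H Hz))) as A2.
pose proof (Cis_series_tail _ _ S1) as A3.
cbv beta in A1, A2, A3.
pose proof (is_series_scal (V := C_NormedModule) (w - z)%C _ _ A3) as A4.
pose proof (is_series_minus (V := C_NormedModule) _ _ _ _
  (is_series_minus (V := C_NormedModule) _ _ _ _ A1 A2) A4) as A5.
match type of A5 with is_series ?U ?L => set (u := U) in A5; set (l := L) in A5 end.
replace (h w - h z - (w - z) * l1)%C with l.
2:{ unfold l, Cderived. 
  match goal with |- _ = ?y => change (
   ((h w - b 0%nat * w ^ 0 - b 1%nat * w ^ 1) - (h z - b 0%nat * z ^ 0 - b 1%nat * z ^ 1)
   - (w - z) * (l1 - INR 1 * b 1%nat * z ^ 0))%C = y) end.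
  simpl; ring. }
apply Rle_trans with (B * Cmod (w - z) ^ 2).
- apply (Cis_series_norm_le u (fun m => PS_derive (PS_derive nb) m * rho ^ m * Cmod (w - z) ^ 2)
    l); [exact A5| |].
  + rewrite (Rmult_comm B).
    apply is_series_ext with (fun m => Cmod (w - z) ^ 2 * (PS_derive (PS_derive nb) m * rho ^ m)).
    { intros n; apply Rmult_comm. }
    exact (is_series_scal (V := R_NormedModule) (Cmod (w - z) ^ 2) _ _ HB).
  + intros m.
    replace (u m) with (b (S (S m)) * 
     (w ^ (S (S m)) - z ^ (S (S m))
       - INR (S (S m)) * z ^ (S m) * (w - z)))%C.
    2:{ unfold u, Cderived.
      match goal with |- ?a = ?c => change (a =
       (b (S (S m)) * w ^ (S (S m))
        - b (S (S m)) * z ^ (S (S m))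
       - (w - z) * (INR (S (S m)) * b (S (S m)) * z ^ (S m)))%C) end.
      ring. }
    rewrite Cmod_mult.
    apply Rle_trans with (Cmod (b (S (S m))) * 
     (INR (S (S m)) * (INR (S m) * rho ^ m) * Cmod (w - z)%C ^ 2)).
    * apply Rmult_le_compat_l; [apply Cmod_ge_0|].
      apply Cpow_taylor2; trivial; unfold rho; lra.
    * apply Req_le; unfold PS_derive, nb; ring.
- pose proof (Cmod_ge_0 (w - z)).
  replace (B * Cmod (w - z) ^ 2) with (B * Cmod (w - z) * Cmod (w - z)) by ring.
  apply Rmult_le_compat_r; trivial.
  apply Rle_trans with (B * (eps / (B + 1))).
  + apply Rmult_le_compat_l; lra.
  + destruct eps as [e He]; simpl.
    apply (Rmult_le_reg_r (B + 1)); [lra|].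
    replace (B * (e / (B + 1)) * (B + 1)) with (B * e) by (field; lra); nra.
Qed.

(** * Exponential, logarithm and powers *)

Lemma Cmod_le_components (z : C) : Cmod z <= Rabs (Re z) + Rabs (Im z).
Proof.
replace z with (RtoC (Re z) + Ci * RtoC (Im z))%C at 1
  by (destruct z; unfold RtoC, Ci, Cplus, Cmult; simpl; f_equal; ring).
apply Rle_trans with (1 := Cmod_triangle _ _).
rewrite Cmod_mult, Cmod_Ci, !Cmod_R; lra.
Qed.

Lemma im_le_Cmod (z : C) : Rabs (Im z) <= Cmod z.
Proof. apply Rle_trans with (2 := Rmax_Cmod z), Rmax_r. Qed.

Lemma is_derive_eps (f : R -> R) (x l : R) (eps : posreal) :
  is_derive f x l ->
  @locally R_UniformSpace x (fun y => Rabs (f y - f x - (y - x) * l) <= eps * Rabs (y - x)).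
Proof. intros [_ H]; exact (H x (fun P HP => HP) eps). Qed.

(** The real expansions of exp, cos and sin at 0, combined in the real and
    imaginary parts of e^x (cos y + i sin y). *)
Lemma Cderiv_exp_0 : Cderiv Cexp 0 1.
Proof.
apply Cderiv_of_eps; intros eps.
assert (He : 0 < Rmin (eps / 8) 1).
{ apply Rmin_glb_lt; [destruct eps as [e e0]; simpl|]; lra. }
set (e := mkposreal _ He).
destruct (is_derive_eps exp 0 _ e (is_derive_exp 0)) as [d1 H1].
destruct (is_derive_eps cos 0 _ e (is_derive_cos 0)) as [d2 H2].
destruct (is_derive_eps sin 0 _ e (is_derive_sin 0)) as [d3 H3].
assert (Hd : 0 < Rmin e (Rmin d1 (Rmin d2 d3))).
{ destruct e, d1, d2, d3; simpl; repeat apply Rmin_glb_lt; trivial. }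
exists (mkposreal _ Hd); simpl; intros h.
replace (h - 0)%C with h by ring; intros Hh.
assert (B0 := Rlt_le_trans _ _ _ Hh (Rmin_l _ _)).
assert (Bx := Rlt_le_trans _ _ _ Hh (Rmin_r _ _)).
assert (B1 := Rlt_le_trans _ _ _ Bx (Rmin_l _ _)).
assert (By := Rlt_le_trans _ _ _ Bx (Rmin_r _ _)).
assert (B2 := Rlt_le_trans _ _ _ By (Rmin_l _ _)).
assert (B3 := Rlt_le_trans _ _ _ By (Rmin_r _ _)).
clear Bx By Hh Hd.
assert (X := re_le_Cmod h); assert (Y := im_le_Cmod h).
destruct h as [x y]; set (m := Cmod (x, y)) in *; simpl in X, Y.
assert (E1 : Rabs (exp x - 1 - x) <= e * Rabs x).
{ specialize (H1 x); rewrite exp_0 in H1.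
  replace (exp x - 1 - (x - 0) * 1) with (exp x - 1 - x) in H1 by ring.
  rewrite Rminus_0_r in H1; apply H1.
  change (Rabs (x - 0) < d1); rewrite Rminus_0_r; lra. }
assert (E2 : Rabs (cos y - 1) <= e * Rabs y).
{ specialize (H2 y); rewrite cos_0, sin_0 in H2.
  replace (cos y - 1 - (y - 0) * - 0) with (cos y - 1) in H2 by ring.
  rewrite Rminus_0_r in H2; apply H2.
  change (Rabs (y - 0) < d2); rewrite Rminus_0_r; lra. }
assert (E3 : Rabs (sin y - y) <= e * Rabs y).
{ specialize (H3 y); rewrite cos_0, sin_0 in H3.
  replace (sin y - 0 - (y - 0) * 1) with (sin y - y) in H3 by ring.
  rewrite Rminus_0_r in H3; apply H3.
  change (Rabs (y - 0) < d3); rewrite Rminus_0_r; lra. }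
assert (He8 : e <= eps / 8) by apply Rmin_l.
assert (He1 : e <= 1) by apply Rmin_r.
assert (e0 := cond_pos e).
assert (B : m < e) by exact B0.
set (ee := pos e) in *; clearbody ee; clear e H1 H2 H3 He B1 B2 B3.
apply Rle_trans with (1 := Cmod_le_components _).
unfold Cexp; simpl; rewrite exp_0, cos_0, sin_0.
replace (exp x * cos y + - (1 * 1) + - (x * 1 - y * 0))
  with ((exp x - 1 - x) * cos y + (1 + x) * (cos y - 1)) by ring.
replace (exp x * sin y + - (1 * 0) + - (x * 0 + y * 1))
  with (((exp x - 1 - x) + x) * ((sin y - y) + y) + (sin y - y)) by ring.
assert (C1 : Rabs (cos y) <= 1) by (apply Rabs_le; pose proof (COS_bound y); lra).
assert (M0 : 0 <= m) by apply Cmod_ge_0.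
pose proof (Rabs_pos x) as x0; pose proof (Rabs_pos y) as y0.
assert (T1 : Rabs ((exp x - 1 - x) * cos y + (1 + x) * (cos y - 1)) <= 3 * ee * m).
{ apply Rle_trans with (1 := Rabs_triang _ _); rewrite !Rabs_mult.
  assert (Rabs (exp x - 1 - x) * Rabs (cos y) <= (ee * m) * 1).
  { apply Rmult_le_compat; try apply Rabs_pos; trivial.
    apply Rle_trans with (1 := E1), Rmult_le_compat_l; lra. }
  assert (Rabs (1 + x) * Rabs (cos y - 1) <= 2 * (ee * m)).
  { apply Rmult_le_compat; try apply Rabs_pos.
    - apply Rle_trans with (1 := Rabs_triang _ _); rewrite Rabs_R1; lra.
    - apply Rle_trans with (1 := E2), Rmult_le_compat_l; lra. }
  lra. }
assert (T2 : Rabs ((exp x - 1 - x + x) * (sin y - y + y) + (sin y - y)) <= 5 * ee * m).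
{ apply Rle_trans with (1 := Rabs_triang _ _); rewrite !Rabs_mult.
  assert (Rabs (exp x - 1 - x + x) * Rabs (sin y - y + y) <= (2 * ee) * (2 * m)).
  { apply Rmult_le_compat; try apply Rabs_pos;
      apply Rle_trans with (1 := Rabs_triang _ _).
    - assert (ee * Rabs x <= 1 * Rabs x) by (apply Rmult_le_compat_r; lra); lra.
    - assert (ee * Rabs y <= 1 * Rabs y) by (apply Rmult_le_compat_r; lra); lra. }
  assert (ee * Rabs y <= ee * m) by (apply Rmult_le_compat_l; lra); lra. }
assert (ee * m <= eps / 8 * m) by (apply Rmult_le_compat_r; lra); lra.
Qed.

Lemma Cderiv_exp z : Cderiv Cexp z (Cexp z).
Proof.
destruct Cderiv_exp_0 as (phi & Hc & H1 & He).
assert (E0 : Cexp 0 = RtoC 1).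
{ unfold Cexp; simpl; rewrite exp_0, cos_0, sin_0; unfold RtoC; f_equal; ring. }
assert (Ct : Ccontinuous (fun w : C => (w - z)%C) z).
{ apply (Ccontinuous_plus (fun w : C => w) (fun _ : C => - z)%C);
  [apply Ccontinuous_id|apply Ccontinuous_const]. }
assert (Z : (z - z)%C = RtoC 0) by ring.
exists (fun w => Cexp z * phi (w - z))%C; split; [|split].
- apply Ccontinuous_mult; [apply Ccontinuous_const|].
  apply (Ccontinuous_comp (fun w => (w - z)%C) phi); [exact Ct|now rewrite Z].
- rewrite Z, H1; ring.
- unfold continuous, filterlim, filter_le, filtermap in Ct; rewrite Z in Ct; apply Ct in He.
  apply filter_imp with (2 := He); intros w E.
  replace w with (z + (w - z))%C at 1 by ring.
  rewrite Cexp_plus, E, E0; ring.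
Qed.

Lemma Ccontinuous_pair {U : UniformSpace} (f g : U -> R) (z : U) :
  @continuous U R_UniformSpace f z -> @continuous U R_UniformSpace g z ->
  @continuous U CU (fun w => (f w, g w)) z.
Proof.
intros Hf Hg; apply (@filterlim_locally U CU (@locally U z) _ (fun w => (f w, g w))).
intros eps.
assert (He : 0 < eps / 2) by (destruct eps; simpl; lra).
assert (A := proj1 (@filterlim_locally U R_UniformSpace (@locally U z) _ f (f z)) Hf (mkposreal _ He)).
assert (B := proj1 (@filterlim_locally U R_UniformSpace (@locally U z) _ g (g z)) Hg (mkposreal _ He)).
apply filter_imp with (2 := filter_and _ _ A B); intros w [a b].
change (Rabs (f w - f z) < eps / 2) in a; change (Rabs (g w - g z) < eps / 2) in b.
apply (Rle_lt_trans _ _ _ (Cmod_le_components ((f w, g w) - (f z, g z))%C)); simpl.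
unfold Rminus in *; lra.
Qed.

Lemma continuous_of_lipschitz (f : C -> R) (z : C) :
  (forall w, Rabs (f w - f z) <= Cmod (w - z)%C) -> @continuous CU R_UniformSpace f z.
Proof.
intros H; apply (@filterlim_locally C R_UniformSpace (@locally CU z) _ f (f z)).
intros eps; exists eps; intros w Hw; exact (Rle_lt_trans _ _ _ (H w) Hw).
Qed.

Lemma continuous_Re (z : C) : @continuous CU R_UniformSpace Re z.
Proof. apply continuous_of_lipschitz; intros w; apply (re_le_Cmod (w - z)%C). Qed.

Lemma continuous_Im (z : C) : @continuous CU R_UniformSpace Im z.
Proof. apply continuous_of_lipschitz; intros w; apply (im_le_Cmod (w - z)%C). Qed.

Lemma Ccontinuous_Clog (w : C) : 0 < Re w -> Ccontinuous Clog w.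
Proof.
intros Hw; apply (@Ccontinuous_pair CU (fun v => ln (Cmod v)) (fun v => atan (Im v / Re v))).
- apply (@continuous_comp CU R_UniformSpace R_UniformSpace Cmod ln).
  + exact (@filterlim_norm C_AbsRing (AbsRing_NormedModule C_AbsRing) w).
  + apply continuous_ln, Cmod_gt_0; intros E; rewrite E in Hw; simpl in Hw; lra.
- apply (@continuous_comp CU R_UniformSpace R_UniformSpace (fun v => Im v / Re v) atan);
   [|apply continuous_atan].
  apply (@continuous_mult CU R_AbsRing Im (fun v => / Re v)); [apply continuous_Im|].
  apply (@continuous_comp CU R_UniformSpace R_UniformSpace Re Rinv); [apply continuous_Re|].
  apply continuous_Rinv; lra.
Qed.

(** Inverse function rule: Clog is a continuous right inverse of Cexp on the
    right half-plane, so the quotient [phi] of Clog is the inverse of that of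
    Cexp, taken along Clog. *)
Lemma Cderiv_Clog (w : C) : 0 < Re w -> Cderiv Clog w (/ w)%C.
Proof.
intros Hw.
assert (HL := Ccontinuous_Clog w Hw).
assert (Hn : w <> RtoC 0) by (intros E; rewrite E in Hw; simpl in Hw; lra).
destruct (Cderiv_exp (Clog w)) as (psi & Hc & H1 & He).
rewrite (Cexp_Clog w Hw) in H1.
assert (Hpsi : Ccontinuous (fun v => psi (Clog v)) w) by now apply (Ccontinuous_comp Clog psi).
exists (fun v => / psi (Clog v))%C; split; [|split].
- apply (Ccontinuous_comp (fun v => psi (Clog v)) Cinv); trivial.
  apply Ccontinuous_inv; cbv beta; now rewrite H1.
- now rewrite H1.
- assert (N := Ccontinuous_neq0 _ w Hpsi ltac:(cbv beta; now rewrite H1)).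
  apply HL in He.
  assert (P := proj1 (@filterlim_locally C R_UniformSpace (@locally CU w) _ Re (Re w))
    (continuous_Re w) (mkposreal _ Hw)).
  apply filter_imp with (2 := filter_and _ _ (filter_and _ _ N He) P).
  intros v [[n E] p].
  change (Rabs (Re v - Re w) < Re w) in p; apply Rabs_def2 in p.
  rewrite (Cexp_Clog w Hw), Cexp_Clog in E by lra.
  replace (v - w)%C with ((Clog v - Clog w) * psi (Clog v))%C by (rewrite E at 3; ring).
  now field.
Qed.

Definition one_minus_pow (s : R) (z : C) : C := Cexp (RtoC s * Clog (1 - z))%C.

Lemma Re_one_minus_pos (z : C) : unit_disk z -> 0 < Re (1 - z)%C.
Proof.
unfold unit_disk; intros Hz; pose proof (re_le_Cmod z) as H.
pose proof (Rle_abs (Re z)); simpl; unfold Re in *; lra.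
Qed.

Lemma Cderiv_one_minus z : Cderiv (fun w => 1 - w)%C z (- (1))%C.
Proof.
exists (fun _ => (- (1))%C); split; [apply Ccontinuous_const|split; [reflexivity|]].
apply Clocally_forall; intros w; ring.
Qed.

Lemma Cderiv_one_minus_pow (s : R) (z : C) :
  unit_disk z ->
  Cderiv (one_minus_pow s) z (- RtoC s * / (1 - z) * one_minus_pow s z)%C.
Proof.
intros Hz; assert (Hp := Re_one_minus_pos z Hz).
assert (D1 := Cderiv_comp _ Clog z _ _ (Cderiv_one_minus z) (Cderiv_Clog _ Hp)).
assert (D2 := Cderiv_mult _ _ z _ _ (Cderiv_const (RtoC s) z) D1).
assert (D3 := Cderiv_comp _ Cexp z _ _ D2 (Cderiv_exp _)).
match type of D3 with Cderiv _ _ ?a =>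
  replace (- RtoC s * / (1 - z) * one_minus_pow s z)%C with a; [exact D3|] end.
unfold one_minus_pow; ring.
Qed.

Lemma one_minus_pow_0 (s : R) : one_minus_pow s 0 = RtoC 1.
Proof.
rewrite <- (q_hpl_0 (- s)); unfold one_minus_pow, q_hpl; f_equal.
rewrite RtoC_opp; ring.
Qed.

(** * Means over circles *)

Definition punctured (z : C) : Prop := 0 < Cmod z < 1.

(** Holomorphic with continuous derivative.  The origin is left out so that
    negative powers of z, which extract coefficients, are included.  The
    continuity of the derivative allows differentiation under the integral
    sign. *)
Definition regular (K : C -> C) : Prop :=
  exists K' : C -> C, forall z, punctured z -> Cderiv K z (K' z) /\ Ccontinuous K' z.

Lemma punctured_neq0 z : punctured z -> z <> RtoC 0.
Proof. intros [H _]; now apply Cmod_gt_0. Qed.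

Lemma regular_continuous K z : regular K -> punctured z -> Ccontinuous K z.
Proof. intros [K' H] Hz; apply (Cderiv_continuous K z (K' z)), H, Hz. Qed.

Lemma regular_const c : regular (fun _ => c).
Proof.
exists (fun _ => RtoC 0); intros z _; split; [apply Cderiv_const|apply Ccontinuous_const].
Qed.

Lemma regular_id : regular (fun z => z).
Proof.
exists (fun _ => RtoC 1); intros z _; split; [apply Cderiv_id|apply Ccontinuous_const].
Qed.

Lemma regular_plus K L : regular K -> regular L -> regular (fun z => K z + L z)%C.
Proof.
intros [K' HK] [L' HL]; exists (fun z => K' z + L' z)%C; intros z Hz.
destruct (HK z Hz), (HL z Hz); split; [now apply Cderiv_plus|now apply Ccontinuous_plus].
Qed.

Lemma regular_mult K L : regular K -> regular L -> regular (fun z => K z * L z)%C.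
Proof.
intros HK HL.
assert (CK := fun z => regular_continuous K z HK); assert (CL := fun z => regular_continuous L z HL).
destruct HK as [K' HK], HL as [L' HL]; exists (fun z => K' z * L z + K z * L' z)%C; intros z Hz.
destruct (HK z Hz), (HL z Hz); split; [now apply Cderiv_mult|].
apply Ccontinuous_plus; apply Ccontinuous_mult; auto.
Qed.

Lemma regular_opp K : regular K -> regular (fun z => - K z)%C.
Proof.
intros HK; destruct (regular_mult (fun _ => (- (1))%C) K (regular_const _) HK) as [L HL].
exists L; intros z Hz; destruct (HL z Hz) as [(phi & H1 & H2 & H3) H4]; split; trivial.
exists phi; repeat split; trivial.
apply filter_imp with (2 := H3); intros w E.
replace (- K w)%C with (- (1) * K w)%C by ring; rewrite E; ring.
Qed.

Lemma regular_minus K L : regular K -> regular L -> regular (fun z => K z - L z)%C.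
Proof. intros HK HL; apply (regular_plus K (fun z => - L z)%C HK), regular_opp, HL. Qed.

Lemma regular_inv K :
  regular K -> (forall z, punctured z -> K z <> RtoC 0) -> regular (fun z => / K z)%C.
Proof.
intros HK Hn.
assert (CK := fun z => regular_continuous K z HK).
destruct HK as [K' HK]; exists (fun z => - K' z / (K z * K z))%C; intros z Hz.
destruct (HK z Hz) as [H1 H2]; split; [apply Cderiv_inv; auto|].
apply Ccontinuous_mult.
- apply (Ccontinuous_ext_loc _ (fun w => (- (1)) * K' w)%C).
  + apply Clocally_forall; intros w.
    change (- (1) * K' w = - K' w :> C)%C; ring.
  + apply Ccontinuous_mult; trivial; apply Ccontinuous_const.
- apply (Ccontinuous_comp (fun w => K w * K w)%C Cinv).
  + apply Ccontinuous_mult; auto.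
  + apply Ccontinuous_inv, Cmult_neq_0; auto.
Qed.

Lemma regular_div K L :
  regular K -> regular L -> (forall z, punctured z -> L z <> RtoC 0) ->
  regular (fun z => K z / L z)%C.
Proof. intros HK HL Hn; apply (regular_mult K (fun z => / L z)%C HK), regular_inv; trivial. Qed.

Lemma regular_pow K n : regular K -> regular (fun z => K z ^ n)%C.
Proof.
intros HK; induction n as [|n IH]; [exact (regular_const 1)|].
exact (regular_mult K _ HK IH).
Qed.

Lemma regular_inv_pow n : regular (fun z => (/ z) ^ n)%C.
Proof.
apply (regular_pow (fun z => / z)%C).
apply (regular_inv (fun z => z)); [apply regular_id|exact punctured_neq0].
Qed.

Lemma regular_one_minus_pow s K :
  regular K -> (forall z, punctured z -> unit_disk (K z)) ->
  regular (fun z => one_minus_pow s (K z)).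
Proof.
intros HK Hd.
assert (CK := fun z => regular_continuous K z HK).
destruct HK as [K' HK].
exists (fun z => K' z * (- RtoC s * / (1 - K z) * one_minus_pow s (K z)))%C; intros z Hz.
destruct (HK z Hz) as [H1 H2]; specialize (Hd z Hz); specialize (CK z Hz); split.
- apply (Cderiv_comp K (one_minus_pow s)); trivial; now apply Cderiv_one_minus_pow.
- apply Ccontinuous_mult; trivial; apply Ccontinuous_mult; [apply Ccontinuous_mult|].
  + apply Ccontinuous_const.
  + apply (Ccontinuous_comp (fun w => 1 - K w)%C Cinv).
    * apply (Ccontinuous_comp K (fun w => 1 - w)%C); trivial.
      apply (Cderiv_continuous _ _ _ (Cderiv_one_minus _)).
    * apply Ccontinuous_inv; intros E.
      pose proof (Re_one_minus_pos _ Hd) as P; rewrite E in P; simpl in P; lra.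
  + apply (Ccontinuous_comp K (one_minus_pow s)); trivial.
    apply (Cderiv_continuous _ _ _ (Cderiv_one_minus_pow s _ Hd)).
Qed.

Lemma regular_disk_pseries b h : disk_pseries b h -> regular h /\ regular (C_derive h).
Proof.
intros H; destruct (disk_pseries_derive b h H) as [H1 D1].
destruct (disk_pseries_derive _ _ H1) as [H2 D2]; destruct (disk_pseries_derive _ _ H2) as [_ D3].
split; [exists (C_derive h)|exists (C_derive (C_derive h))]; intros z [_ Hz]; split; auto.
- exact (Cderiv_continuous _ _ _ (D2 z Hz)).
- exact (Cderiv_continuous _ _ _ (D3 z Hz)).
Qed.

Definition circ (r t : R) : C := (r * cos t, r * sin t).

Lemma circ_exp r t : circ r t = (RtoC r * Cexp (Ci * RtoC t))%C.
Proof.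
unfold circ, Cexp, Ci, RtoC, Cmult; simpl.
replace (0 * t - 1 * 0) with 0 by ring; replace (0 * 0 + 1 * t) with t by ring.
rewrite exp_0; f_equal; ring.
Qed.

Lemma Cmod_circ r t : 0 <= r -> Cmod (circ r t) = r.
Proof.
intros Hr; unfold Cmod, circ; simpl.
replace (r * cos t * (r * cos t * 1) + r * sin t * (r * sin t * 1))
  with (r * r * (Rsqr (sin t) + Rsqr (cos t))) by (unfold Rsqr; ring).
rewrite sin2_cos2, Rmult_1_r; now apply sqrt_square.
Qed.

Lemma punctured_circ r t : 0 < r < 1 -> punctured (circ r t).
Proof. intros Hr; unfold punctured; rewrite Cmod_circ; lra. Qed.

Lemma continuous_circ {U : UniformSpace} (f g : U -> R) (x : U) :
  @continuous U R_UniformSpace f x -> @continuous U R_UniformSpace g x ->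
  @continuous U CU (fun w => circ (f w) (g w)) x.
Proof.
intros Hf Hg; unfold circ; apply Ccontinuous_pair.
- apply (@continuous_mult U R_AbsRing f (fun w => cos (g w))); trivial.
  apply (@continuous_comp U R_UniformSpace R_UniformSpace g cos); trivial.
  apply continuous_cos.
- apply (@continuous_mult U R_AbsRing f (fun w => sin (g w))); trivial.
  apply (@continuous_comp U R_UniformSpace R_UniformSpace g sin); trivial.
  apply continuous_sin.
Qed.

Definition mean (r : R) (K : C -> C) : R :=
  RInt (fun t => Re (K (circ r t))) 0 (2 * PI) / (2 * PI).

Lemma regular_ex_RInt K r a b :
  regular K -> 0 < r < 1 -> ex_RInt (fun t => Re (K (circ r t))) a b.
Proof.
intros HK Hr; apply (ex_RInt_continuous (V := R_CompleteNormedModule)); intros t _.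
apply (@continuous_comp R_UniformSpace CU R_UniformSpace (fun t => K (circ r t)) Re);
  [|apply continuous_Re].
apply (@continuous_comp R_UniformSpace CU CU (circ r) K).
- apply (continuous_circ (fun _ => r) (fun t => t)); [apply continuous_const|apply continuous_id].
- apply regular_continuous; trivial; now apply punctured_circ.
Qed.

(** Here [p] is the real or the imaginary part. *)
Lemma is_derive_line (f : C -> C) (t : R) (l : C) (p : C -> R) :
  (forall z w : C, p (z - w)%C = p z - p w) -> (forall (x : R) z, p (RtoC x * z)%C = x * p z) ->
  (forall z, Rabs (p z) <= Cmod z) ->
  Cderiv f (RtoC t) l -> is_derive (fun u : R => p (f (RtoC u))) t (p l).
Proof.
intros Hm Hs Hb H; split; [apply (is_linear_scal_l (V := R_NormedModule))|].
intros x Hx eps.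
rewrite <- (is_filter_lim_locally_unique (V := R_NormedModule) t x Hx).
destruct (Cderiv_eps f (RtoC t) l eps H) as [d Hd].
exists d; intros u Hu; specialize (Hd (RtoC u)).
assert (E : Cmod (RtoC u - RtoC t)%C = Rabs (u - t)) by now rewrite <- RtoC_minus, Cmod_R.
change (Cmod (RtoC u - RtoC t)%C < d ->
  Cmod (f (RtoC u) - f (RtoC t) - (RtoC u - RtoC t) * l)%C <= eps * Cmod (RtoC u - RtoC t)%C) in Hd.
rewrite E in Hd; specialize (Hd Hu).
change (Rabs (p (f (RtoC u)) - p (f (RtoC t)) - (u - t) * p l) <= eps * Rabs (u - t)).
rewrite <- Hm, <- Hs, <- Hm, RtoC_minus.
apply Rle_trans with (2 := Hd), Hb.
Qed.

Lemma is_derive_line_Re (f : C -> C) (t : R) (l : C) :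
  Cderiv f (RtoC t) l -> is_derive (fun u : R => Re (f (RtoC u))) t (Re l).
Proof.
apply is_derive_line; [| |apply re_le_Cmod]; intros; unfold Re, RtoC; simpl; ring.
Qed.

Lemma is_derive_line_Im (f : C -> C) (t : R) (l : C) :
  Cderiv f (RtoC t) l -> is_derive (fun u : R => Im (f (RtoC u))) t (Im l).
Proof.
apply is_derive_line; [| |apply im_le_Cmod]; intros; unfold Im, RtoC; simpl; ring.
Qed.

Lemma is_derive_radial K l r t :
  Cderiv K (circ r t) l ->
  is_derive (fun u => Re (K (circ u t))) r (Re (l * Cexp (Ci * RtoC t))%C).
Proof.
intros H; rewrite circ_exp in H; set (e := Cexp (Ci * RtoC t)) in *.
apply is_derive_ext with (fun u => Re ((fun w => K (w * e)%C) (RtoC u))).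
{ intros u; now rewrite circ_exp. }
apply (is_derive_line_Re (fun w => K (w * e)%C)).
assert (D := Cderiv_comp (fun w => w * e)%C K (RtoC r) _ _
  (Cderiv_mult (fun w => w) (fun _ => e) _ _ _ (Cderiv_id _) (Cderiv_const _ _)) H).
cbv beta in D.
match type of D with Cderiv _ _ ?a => replace (l * e)%C with a by ring end; exact D.
Qed.

Lemma is_derive_angular K l r t :
  Cderiv K (circ r t) l ->
  is_derive (fun u => Im (K (circ r u))) t (r * Re (l * Cexp (Ci * RtoC t))%C).
Proof.
intros H; rewrite circ_exp in H; set (e := Cexp (Ci * RtoC t)) in *.
apply is_derive_ext with (fun u => Im ((fun w => K (RtoC r * Cexp (Ci * w))%C) (RtoC u))).
{ intros u; now rewrite circ_exp. }
replace (r * Re (l * e)%C) with (Im (Ci * RtoC r * (l * e))%C)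
  by (unfold Ci, RtoC, Re, Im; simpl; ring).
apply (is_derive_line_Im (fun w => K (RtoC r * Cexp (Ci * w))%C)).
assert (D := Cderiv_comp (fun w => RtoC r * Cexp (Ci * w))%C K (RtoC t) _ _
  (Cderiv_mult (fun _ => RtoC r) (fun w => Cexp (Ci * w)) _ _ _ (Cderiv_const _ _)
    (Cderiv_comp (fun w => Ci * w)%C Cexp _ _ _
      (Cderiv_mult (fun _ => Ci) (fun w => w) _ _ _ (Cderiv_const _ _) (Cderiv_id _))
      (Cderiv_exp _))) H).
fold e in D; cbv beta in D.
match type of D with Cderiv _ _ ?a => replace (Ci * r * (l * e))%C with a by ring end; exact D.
Qed.

(** Cauchy's theorem for circles.  The radial derivative of Re K is
    Re (K' e^(it)), and r times that is the derivative of Im K along the circle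
    (Cauchy-Riemann equations in polar form); its integral over a period
    vanishes. *)
Lemma is_derive_mean_integral K r :
  regular K -> 0 < r < 1 ->
  is_derive (fun u => RInt (fun t => Re (K (circ u t))) 0 (2 * PI)) r 0.
Proof.
intros HK Hr; assert (HK0 := HK); destruct HK as [K' HK].
assert (Hloc : @locally R_UniformSpace r (fun u => 0 < u < 1)).
{ apply filter_and; [apply (open_gt 0)|apply (open_lt 1)]; lra. }
assert (D : forall u t, 0 < u < 1 -> 
  is_derive (fun u => Re (K (circ u t))) u (Re (K' (circ u t) * Cexp (Ci * RtoC t))%C)).
{ intros u t Hu; apply is_derive_radial, HK; now apply punctured_circ. }
assert (Cj : forall t, @continuous (prod_UniformSpace R_UniformSpace R_UniformSpace) R_UniformSpace
  (fun p => Re (K' (circ (fst p) (snd p)) * Cexp (Ci * RtoC (snd p)))%C) (r, t)).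
{ intros t.
  apply (@continuous_comp _ CU R_UniformSpace (fun p : R * R => (K' (circ (fst p) (snd p)) * Cexp (Ci * RtoC (snd p)))%C) Re);
  [|apply continuous_Re].
  apply (@continuous_mult _ C_AbsRing (fun p : R * R => K' (circ (fst p) (snd p)))
     (fun p : R * R => Cexp (Ci * RtoC (snd p)))).
  - apply (@continuous_comp _ CU CU (fun p : R * R => circ (fst p) (snd p)) K').
    + apply continuous_circ; [apply continuous_fst|apply continuous_snd].
    + apply HK; now apply punctured_circ.
  - apply (@continuous_ext _ CU (fun p : R * R => circ 1 (snd p))).
    + intros p; rewrite circ_exp; apply Cmult_1_l.
    + apply (continuous_circ (fun _ => 1) snd); [apply continuous_const|apply continuous_snd]. }
enough (E : RInt (fun t => Derive (fun u => Re (K (circ u t))) r) 0 (2 * PI) = 0).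
- apply (eq_ind _ (is_derive (V := R_NormedModule) _ r)) with (2 := E).
  apply (is_derive_RInt_param (fun u t => Re (K (circ u t)))).
  + apply filter_imp with (2 := Hloc); intros u Hu t _; eexists; now apply D.
  + intros t _.
    apply continuity_2d_pt_ext_loc with (fun u v => Re (K' (circ u v) * Cexp (Ci * RtoC v))%C).
    * apply locally_2d_locally.
      destruct Hloc as [d Hd]; exists d; intros [u v] [Hu Hv]; simpl.
      symmetry; apply is_derive_unique, D, Hd, Hu.
    * apply continuity_2d_pt_filterlim, Cj.
  + apply filter_imp with (2 := Hloc); intros u Hu; now apply regular_ex_RInt.
- rewrite (RInt_ext _ (fun t => Re (K' (circ r t) * Cexp (Ci * RtoC t))%C)).
  2:{ intros t _; now apply is_derive_unique, D. }
  apply (is_RInt_unique (V := R_CompleteNormedModule)).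
  apply (is_RInt_ext (V := R_NormedModule)
    (fun t => scal (/ r) (r * Re (K' (circ r t) * Cexp (Ci * RtoC t))%C))).
  { intros t _; change (/ r * (r * Re (K' (circ r t) * Cexp (Ci * RtoC t))%C) = 
      Re (K' (circ r t) * Cexp (Ci * RtoC t))%C); field; lra. }
  enough (E : scal (/ r) (minus (Im (K (circ r (2 * PI)))) (Im (K (circ r 0)))) = 0).
  + apply (eq_ind _ (is_RInt (V := R_NormedModule) _ 0 (2 * PI))) with (2 := E).
    apply (is_RInt_scal (V := R_NormedModule)).
    apply (is_RInt_derive (V := R_CompleteNormedModule) (fun t => Im (K (circ r t)))).
    * intros t _; apply is_derive_angular, HK; now apply punctured_circ.
    * intros t _; apply (@continuous_mult _ R_AbsRing (fun _ => r)); [apply continuous_const|].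
      apply (@continuous_comp _ _ R_UniformSpace (fun t : R => (r, t))
        (fun p : R * R => Re (K' (circ (fst p) (snd p)) * Cexp (Ci * RtoC (snd p)))%C));
        [|apply Cj].
      apply (continuous_comp_2 (fun _ : R => r) (fun t : R => t) (fun x y => (x, y)));
       [apply continuous_const|apply continuous_id|].
      apply (continuous_ext (fun p : R * R => p)); [now intros []|apply continuous_id].
  + unfold circ; rewrite cos_2PI, sin_2PI, cos_0, sin_0.
    change (/ r * (Im (K (r * 1, r * 0)) - Im (K (r * 1, r * 0))) = 0); ring.
Qed.

Lemma mean_radius K r1 r2 :
  regular K -> 0 < r1 < 1 -> 0 < r2 < 1 -> mean r1 K = mean r2 K.
Proof.
intros HK.
assert (G : forall a b, 0 < a -> a < b -> b < 1 -> mean a K = mean b K).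
{ intros a b Ha Hab Hb; unfold mean; f_equal.
  apply (eq_is_derive (V := R_NormedModule) 
     (fun u => RInt (fun t => Re (K (circ u t))) 0 (2 * PI)) a b); trivial.
  intros t Ht; apply is_derive_mean_integral; trivial; lra. }
intros H1 H2; destruct (Rtotal_order r1 r2) as [h|[->|h]]; trivial.
- apply G; lra.
- symmetry; apply G; lra.
Qed.

Lemma mean_le K L r :
  regular K -> regular L -> 0 < r < 1 ->
  (forall z, Cmod z = r -> Re (K z) <= Re (L z)) -> mean r K <= mean r L.
Proof.
intros HK HL Hr H; pose proof PI_RGT_0; unfold mean.
apply Rmult_le_compat_r; [apply Rlt_le, Rinv_0_lt_compat; lra|].
apply RInt_le; [lra|now apply regular_ex_RInt|now apply regular_ex_RInt|].
intros t _; apply H, Cmod_circ; lra.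
Qed.

Lemma mean_ext K L r :
  regular K -> regular L -> 0 < r < 1 ->
  (forall z, Cmod z = r -> Re (K z) = Re (L z)) -> mean r K = mean r L.
Proof.
intros HK HL Hr H; apply Rle_antisym; apply mean_le; trivial; intros z Hz; rewrite H; trivial; lra.
Qed.

Lemma mean_const c r : mean r (fun _ => c) = Re c.
Proof.
unfold mean; rewrite RInt_const; unfold scal; simpl; unfold mult; simpl.
pose proof PI_RGT_0; field; lra.
Qed.

Lemma mean_plus K L r :
  regular K -> regular L -> 0 < r < 1 ->
  mean r (fun z => K z + L z)%C = mean r K + mean r L.
Proof.
intros HK HL Hr; unfold mean.
rewrite (RInt_ext _ (fun t => plus (Re (K (circ r t))) (Re (L (circ r t))))) by reflexivity.
rewrite (RInt_plus (V := R_CompleteNormedModule)) by now apply regular_ex_RInt.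
change (plus ?a ?b) with (a + b); pose proof PI_RGT_0; field; lra.
Qed.

Lemma mean_scal K (x r : R) :
  regular K -> 0 < r < 1 -> mean r (fun z => RtoC x * K z)%C = x * mean r K.
Proof.
intros HK Hr; unfold mean.
rewrite (RInt_ext _ (fun t => scal x (Re (K (circ r t))))).
2:{ intros t _; change (scal x ?a) with (x * a); unfold Re, RtoC; simpl; ring. }
rewrite (RInt_scal (V := R_CompleteNormedModule)) by now apply regular_ex_RInt.
change (scal ?a ?b) with (a * b); pose proof PI_RGT_0; field; lra.
Qed.

(** Limit at the origin along nonzero points. *)
Definition tends0 (K : C -> C) (l : C) : Prop :=
  forall eps : posreal, exists d : posreal,
    forall z, 0 < Cmod z < d -> Cmod (K z - l)%C < eps.

(** The mean is the same on arbitrarily small circles, where K is close to l. *)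
Lemma mean_tends0 K l r : regular K -> tends0 K l -> 0 < r < 1 -> mean r K = Re l.
Proof.
intros HK Hl Hr.
apply cond_eq; intros eps He.
assert (He2 : 0 < eps / 2) by lra.
destruct (Hl (mkposreal _ He2)) as [d Hd]; simpl in Hd.
set (e := Rmin d 1 / 2).
assert (He1 : 0 < e < d /\ e < 1).
{ unfold e; destruct d as [d d0]; simpl; unfold Rmin; destruct Rle_dec; lra. }
rewrite (mean_radius K r e) by (trivial; lra).
assert (B : forall z, Cmod z = e -> Re l - eps / 2 <= Re (K z) <= Re l + eps / 2).
{ intros z Hz; specialize (Hd z ltac:(lra)).
  pose proof (re_le_Cmod (K z - l)%C) as T.
  replace (Re (K z - l)%C) with (Re (K z) - Re l) in T by (unfold Re; simpl; ring).
  pose proof (Rle_abs (Re (K z) - Re l)); pose proof (Rle_abs (- (Re (K z) - Re l))) as T2.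
  rewrite Rabs_Ropp in T2; lra. }
assert (L1 := mean_le (fun _ => RtoC (Re l - eps / 2)) K e (regular_const _) HK ltac:(lra)
  (fun z Hz => proj1 (B z Hz))).
assert (L2 := mean_le K (fun _ => RtoC (Re l + eps / 2)) e HK (regular_const _) ltac:(lra)
  (fun z Hz => proj2 (B z Hz))).
rewrite mean_const in L1, L2; simpl in L1, L2.
apply Rabs_def1; lra.
Qed.

Lemma tends0_const c : tends0 (fun _ => c) c.
Proof.
intros eps; exists eps; intros z _.
replace (c - c)%C with (RtoC 0) by ring; rewrite Cmod_0; apply eps.
Qed.

Lemma tends0_id : tends0 (fun z => z) 0.
Proof. intros eps; exists eps; intros z Hz; replace (z - 0)%C with z by ring; apply Hz. Qed.

Lemma Cminus_0_r (z : C) : (z - 0)%C = z.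
Proof. ring. Qed.

Lemma tends0_filterlim K l :
  tends0 K l <-> filterlim K (within (fun z : C => z <> RtoC 0) (@locally CU (RtoC 0))) (@locally CU l).
Proof.
split.
- intros H; apply (@filterlim_locally C CU _ _ K l); intros eps.
  destruct (H eps) as [d Hd]; exists d; intros z Hz Hn; apply Hd; split.
  + now apply Cmod_gt_0.
  + change (Cmod (z - 0)%C < d) in Hz; rewrite Cminus_0_r in Hz; exact Hz.
- intros H eps.
  destruct (proj1 (@filterlim_locally C CU _ _ K l) H eps) as [d Hd].
  exists d; intros z [Hz1 Hz2]; apply Hd.
  + change (Cmod (z - 0)%C < d); rewrite Cminus_0_r; exact Hz2.
  + now apply Cmod_gt_0.
Qed.

Lemma tends0_plus K L k l : tends0 K k -> tends0 L l -> tends0 (fun z => K z + L z)%C (k + l)%C.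
Proof.
rewrite !tends0_filterlim; intros HK HL.
exact (filterlim_comp_2 _ _ _ HK HL (@filterlim_plus C_AbsRing (AbsRing_NormedModule C_AbsRing) k l)).
Qed.

Lemma tends0_mult K L k l : tends0 K k -> tends0 L l -> tends0 (fun z => K z * L z)%C (k * l)%C.
Proof.
rewrite !tends0_filterlim; intros HK HL.
exact (filterlim_comp_2 _ _ _ HK HL (@filterlim_mult C_AbsRing k l)).
Qed.

Lemma tends0_comp K L k : tends0 K k -> Ccontinuous L k -> tends0 (fun z => L (K z)) (L k).
Proof. rewrite !tends0_filterlim; intros HK HL; exact (filterlim_comp _ _ _ _ _ _ _ _ HK HL). Qed.

Lemma tends0_ext K L l : (forall z, punctured z -> K z = L z) -> tends0 K l -> tends0 L l.
Proof.
intros H HK eps; destruct (HK eps) as [d Hd].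
assert (H0 : 0 < Rmin d 1) by (destruct d; simpl; apply Rmin_glb_lt; lra).
exists (mkposreal _ H0); simpl; intros z [Hz1 Hz2].
assert (A := Rlt_le_trans _ _ _ Hz2 (Rmin_l _ _)).
assert (B := Rlt_le_trans _ _ _ Hz2 (Rmin_r _ _)).
rewrite <- H by (split; lra); apply Hd; lra.
Qed.

Lemma tends0_continuous (f : C -> C) : Ccontinuous f (RtoC 0) -> tends0 f (f (RtoC 0)).
Proof. exact (tends0_comp (fun z => z) f (RtoC 0) tends0_id). Qed.

Lemma tends0_slope f l : Cderiv f 0 l -> tends0 (fun z => (f z - f 0) / z)%C l.
Proof.
intros (phi & Hc & <- & [d0 He]) eps.
destruct (proj1 (Ccontinuous_eps phi (RtoC 0)) Hc eps) as [d Hd].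
assert (H0 : 0 < Rmin d d0) by (destruct d, d0; simpl; apply Rmin_glb_lt; lra).
exists (mkposreal _ H0); simpl; intros z [Hz1 Hz2].
assert (A := Rlt_le_trans _ _ _ Hz2 (Rmin_l _ _)).
assert (B := Rlt_le_trans _ _ _ Hz2 (Rmin_r _ _)).
assert (Z : (z - 0)%C = z) by ring.
specialize (Hd z ltac:(change (Cmod (z - 0)%C < d); now rewrite Z)).
specialize (He z ltac:(change (Cmod (z - 0)%C < d0); now rewrite Z)).
cbv beta in He; rewrite He, Z.
apply Cmod_gt_0 in Hz1.
replace ((f 0 + z * phi z - f 0) / z)%C with (phi z) by now field.
exact Hd.
Qed.

(** * The pointwise inequality *)

(** The derivative - tan of ln cos is decreasing, so the graph of ln cos lies
    below its tangents. *)
Lemma ln_cos_tangent (x y : R) :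
  - (PI / 2) < x < PI / 2 -> - (PI / 2) < y < PI / 2 ->
  ln (cos y) <= ln (cos x) - tan x * (y - x).
Proof.
intros Hx Hy.
assert (Hc : forall u, Rmin x y <= u <= Rmax x y -> 0 < cos u /\ - (PI / 2) < u < PI / 2).
{ intros u Hu.
  assert (- (PI / 2) < u < PI / 2) by (unfold Rmin, Rmax in Hu; destruct Rle_dec; lra).
  split; trivial; apply cos_gt_0; lra. }
assert (D : forall u, Rmin x y <= u <= Rmax x y -> is_derive (fun u => ln (cos u)) u (- tan u)).
{ intros u Hu; destruct (Hc u Hu) as [H _]; unfold tan; auto_derive; [exact H|field; lra]. }
destruct (MVT_gen (fun u => ln (cos u)) x y (fun u => - tan u)) as (c & Hc1 & E).
- intros u Hu; apply D; lra.
- intros u Hu; apply continuity_pt_filterlim.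
  apply (ex_derive_continuous (fun u => ln (cos u))); eexists; now apply D.
- assert (tan x * (y - x) <= tan c * (y - x)); [|lra].
  destruct (Hc c Hc1) as [_ Bc].
  destruct (Rle_lt_dec x y) as [h|h].
  + rewrite Rmin_left, Rmax_right in Hc1 by lra.
    apply Rmult_le_compat_r; [lra|].
    destruct (Req_dec x c) as [->|n]; [lra|]; apply Rlt_le, tan_increasing; lra.
  + rewrite Rmin_right, Rmax_left in Hc1 by lra.
    assert (tan c <= tan x); [|nra].
    destruct (Req_dec x c) as [->|n]; [lra|]; apply Rlt_le, tan_increasing; lra.
Qed.

Lemma convex_comb_bounds (s a b l u : R) :
  0 <= s <= 1 -> l < a < u -> l < b < u -> l < (1 - s) * a + s * b < u.
Proof.
intros Hs Ha Hb; destruct (Rle_lt_dec a b) as [h|h].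
- assert (0 <= s * (b - a) /\ 0 <= (1 - s) * (b - a)) as [] by (split; apply Rmult_le_pos; lra); lra.
- assert (0 <= s * (a - b) /\ 0 <= (1 - s) * (a - b)) as [] by (split; apply Rmult_le_pos; lra); lra.
Qed.

Lemma ln_cos_concave (s a b : R) :
  0 <= s <= 1 -> - (PI / 2) < a < PI / 2 -> - (PI / 2) < b < PI / 2 ->
  (1 - s) * ln (cos a) + s * ln (cos b) <= ln (cos ((1 - s) * a + s * b)).
Proof.
intros Hs Ha Hb; set (c := (1 - s) * a + s * b).
assert (Hc : - (PI / 2) < c < PI / 2) by now apply convex_comb_bounds.
assert (Ta := ln_cos_tangent c a Hc Ha); assert (Tb := ln_cos_tangent c b Hc Hb).
assert (E : (1 - s) * (a - c) + s * (b - c) = 0) by (unfold c; ring).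
assert ((1 - s) * ln (cos a) <= (1 - s) * (ln (cos c) - tan c * (a - c)))
  by (apply Rmult_le_compat_l; lra).
assert (s * ln (cos b) <= s * (ln (cos c) - tan c * (b - c)))
  by (apply Rmult_le_compat_l; lra).
replace (ln (cos c)) with ((1 - s) * (ln (cos c) - tan c * (a - c))
  + s * (ln (cos c) - tan c * (b - c)) + tan c * ((1 - s) * (a - c) + s * (b - c))) by ring.
rewrite E; lra.
Qed.

(** The disk |w| < 1 in polar coordinates around 1: with 1 - w = r e^(ia) it is
    given by r < 2 cos a, because |w|^2 = r^2 - 2 r cos a + 1. *)
Lemma one_minus_polar (w : C) :
  unit_disk w ->
  exists r a, 0 < r /\ - (PI / 2) < a < PI / 2 /\
    (1 - w)%C = (r * cos a, r * sin a) /\ Clog (1 - w) = (ln r, a) /\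
    r < 2 * cos a /\ r ^ 2 = 2 * (r * cos a) - 1 + Cmod w ^ 2.
Proof.
intros Hw; assert (Hp := Re_one_minus_pos w Hw).
set (v := (1 - w)%C) in *.
assert (Hm : 0 < Cmod v) by (apply Cmod_gt_0; intros E; rewrite E in Hp; simpl in Hp; lra).
assert (E := Cexp_Clog v Hp).
exists (Cmod v), (atan (Im v / Re v)).
assert (Ev : v = (Cmod v * cos (atan (Im v / Re v)), Cmod v * sin (atan (Im v / Re v)))).
{ rewrite <- E at 1; unfold Cexp, Clog; simpl; now rewrite exp_ln. }
set (a := atan _) in *; set (r := Cmod v) in *.
assert (Er : r ^ 2 = 2 * (r * cos a) - 1 + Cmod w ^ 2).
{ assert (R1 : r * cos a = 1 - Re w) by (change (fst (r * cos a, r * sin a) = 1 - Re w);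
    rewrite <- Ev; unfold v, Re; simpl; ring).
  rewrite R1; unfold r; rewrite !Cmod2_alt; unfold v, Re, Im; simpl; ring. }
split; [exact Hm|]; split; [unfold a; pose proof (atan_bound (Im v / Re v)); lra|]; split; [exact Ev|].
split; [reflexivity|]; split; [|exact Er].
unfold unit_disk in Hw; pose proof (Cmod_ge_0 w).
assert (Cmod w ^ 2 < 1) by nra.
apply (Rmult_lt_reg_l r); trivial; nra.
Qed.

(** With 1 - z = rho e^(ib) and 1 - w = r e^(ia), the left side is rho^2 / 2 and
    the right side is (rho / r)^s rho cos ((1-s) b + s a).  Concavity of ln cos
    bounds the cosine below by (cos b)^(1-s) (cos a)^s; then r < 2 cos a and
    rho < 2 cos b give the claim.  Geometrically, this is the convexity of the
    image of the disk under q_s. *)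
Lemma kernel_lower_bound (s : R) (z w : C) :
  0 < s <= 1 -> unit_disk z -> unit_disk w ->
  Cmod (1 - z)%C ^ 2 / 2 <= Re (one_minus_pow s z * Cconj (1 - z) * q_hpl s w)%C.
Proof.
intros Hs Hz Hw.
destruct (one_minus_polar z Hz) as (rho & b & Hrho & Hb & Ez & Lz & Bz & Qz).
destruct (one_minus_polar w Hw) as (r & a & Hr & Ha & Ew & Lw & Bw & Qw).
set (g := (1 - s) * b + s * a).
assert (E : Re (one_minus_pow s z * Cconj (1 - z) * q_hpl s w)%C
  = exp (s * ln rho) * rho * exp (- (s * ln r)) * cos g).
{ unfold one_minus_pow, q_hpl; rewrite Lz, Lw, Ez.
  unfold Cexp, Cconj, RtoC, Cmult, Copp, Re, Im; simpl.
  replace (s * ln rho - 0 * b) with (s * ln rho) by ring.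
  replace (s * b + 0 * ln rho) with (s * b) by ring.
  replace (- (s * ln r - 0 * a)) with (- (s * ln r)) by ring.
  replace (- (s * a + 0 * ln r)) with (- (s * a)) by ring.
  unfold g; replace ((1 - s) * b + s * a) with (b - (s * b - s * a)) by ring.
  rewrite (cos_minus b), cos_minus, sin_minus, cos_neg, sin_neg; ring. }
rewrite E.
assert (Em : Cmod (1 - z)%C ^ 2 = rho ^ 2).
{ rewrite Cmod2_alt, Ez; simpl.
  replace (rho * cos b * (rho * cos b * 1) + rho * sin b * (rho * sin b * 1))
    with (rho * rho * (Rsqr (sin b) + Rsqr (cos b))) by (unfold Rsqr; ring).
  rewrite sin2_cos2; ring. }
rewrite Em.
assert (Ca : 0 < cos a) by (apply cos_gt_0; lra).
assert (Cb : 0 < cos b) by (apply cos_gt_0; lra).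
assert (Hg : - (PI / 2) < g < PI / 2) by (apply convex_comb_bounds; trivial; lra).
assert (Cg : 0 < cos g) by (apply cos_gt_0; lra).
assert (LC := ln_cos_concave s b a ltac:(lra) Hb Ha); fold g in LC.
assert (L1 : ln r <= ln 2 + ln (cos a)).
{ rewrite <- ln_mult by lra; apply Rlt_le, ln_increasing; lra. }
assert (L2 : ln rho <= ln 2 + ln (cos b)).
{ rewrite <- ln_mult by lra; apply Rlt_le, ln_increasing; lra. }
replace (rho ^ 2 / 2) with (exp (ln rho + ln rho - ln 2)).
2:{ unfold Rminus; rewrite !exp_plus, exp_Ropp, !exp_ln by lra; field. }
replace (exp (s * ln rho) * rho * exp (- (s * ln r)) * cos g)
  with (exp (s * ln rho + ln rho - s * ln r + ln (cos g))).
2:{ unfold Rminus; rewrite !exp_plus, !exp_ln by lra; ring. }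
assert (s * ln r <= s * (ln 2 + ln (cos a))) by (apply Rmult_le_compat_l; lra).
assert ((1 - s) * ln rho <= (1 - s) * (ln 2 + ln (cos b))) by (apply Rmult_le_compat_l; lra).
destruct (Rle_lt_or_eq_dec (ln rho + ln rho - ln 2) (s * ln rho + ln rho - s * ln r + ln (cos g))) as [h|h].
- lra.
- apply Rlt_le, exp_increasing, h.
- rewrite h; lra.
Qed.

(** * Coefficient bounds *)

Lemma tends0_comp0 K L l :
  tends0 K 0 -> tends0 L l -> (forall z, punctured z -> K z <> RtoC 0) ->
  tends0 (fun z => L (K z)) l.
Proof.
intros HK HL Hn eps.
destruct (HL eps) as [d Hd], (HK d) as [e He].
assert (H0 : 0 < Rmin e 1) by (destruct e; simpl; apply Rmin_glb_lt; lra).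
exists (mkposreal _ H0); simpl; intros z [Hz1 Hz2].
assert (A := Rlt_le_trans _ _ _ Hz2 (Rmin_l _ _)).
assert (B := Rlt_le_trans _ _ _ Hz2 (Rmin_r _ _)).
apply Hd; split.
- apply Cmod_gt_0, Hn; split; lra.
- specialize (He z (conj Hz1 A)); now rewrite Cminus_0_r in He.
Qed.

Lemma tends0_monomial (c : C) (k : nat) : (1 <= k)%nat -> tends0 (fun z => c * z ^ k)%C 0.
Proof.
intros Hk; destruct k as [|k]; [lia|]; clear Hk.
assert (H : forall n, exists l, tends0 (fun z => z ^ n)%C l).
{ induction n as [|n [l Hl]]; [exists (RtoC 1); exact (tends0_const 1)|].
  exists (0 * l)%C; exact (tends0_mult _ _ _ _ tends0_id Hl). }
destruct (H k) as [l Hl].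
replace (RtoC 0) with (c * (0 * l))%C by ring.
exact (tends0_mult _ _ _ _ (tends0_const c) (tends0_mult _ _ _ _ tends0_id Hl)).
Qed.

Lemma regular_monomial (c : C) (k : nat) : regular (fun z => c * z ^ k)%C.
Proof.
exact (regular_mult _ _ (regular_const c) (regular_pow _ k regular_id)).
Qed.

Lemma regular_inv_monomial (c : C) (k : nat) : regular (fun z => c * (/ z) ^ k)%C.
Proof. exact (regular_mult _ _ (regular_const c) (regular_inv_pow k)). Qed.

(** On the circle |z| = r, z^(-k) is conj(z^k) / r^(2k), so the mean is that of a
    monomial, which vanishes at the origin. *)
Lemma mean_inv_monomial (c : C) (k : nat) (r : R) :
  (1 <= k)%nat -> 0 < r < 1 -> mean r (fun z => c * (/ z) ^ k)%C = 0.
Proof.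
intros Hk Hr.
set (m := (Cconj c * RtoC (/ (r ^ k) ^ 2))%C).
assert (Hrk : 0 < r ^ k) by (apply pow_lt; lra).
rewrite (mean_ext _ (fun z => m * z ^ k)%C).
- now rewrite (mean_tends0 _ 0 r (regular_monomial m k) (tends0_monomial m k Hk) Hr).
- apply regular_inv_monomial.
- apply regular_monomial.
- exact Hr.
- intros z Hz.
  assert (Hz0 : z <> RtoC 0) by (apply Cmod_gt_0; lra).
  assert (E : (z ^ k * Cconj (z ^ k))%C = RtoC ((r ^ k) ^ 2)).
  { rewrite <- Cmod2_conj, Cmod_pow, Hz; reflexivity. }
  assert (Hzk : (z ^ k)%C <> RtoC 0) by now apply Cpow_nz.
  replace ((/ z) ^ k)%C with (Cconj (z ^ k) * RtoC (/ (r ^ k) ^ 2))%C.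
  + unfold m, Cconj, RtoC, Cmult, Re; simpl; ring.
  + rewrite Cpow_inv by exact Hz0.
    rewrite RtoC_inv by (apply Rgt_not_eq, pow_lt, Hrk); rewrite <- E.
    assert (Hc : Cconj (z ^ k) <> RtoC 0).
    { apply Cmod_gt_0; rewrite Cmod_conj; now apply Cmod_gt_0. }
    now field.
Qed.

Lemma bernoulli_lower (e : R) (n : nat) : 0 <= e <= 1 -> 1 - INR n * e <= (1 - e) ^ n.
Proof.
intros He; induction n as [|n IH]; [simpl; lra|].
rewrite S_INR; simpl.
assert ((1 - e) * (1 - INR n * e) <= (1 - e) * (1 - e) ^ n) by (apply Rmult_le_compat_l; lra).
pose proof (pos_INR n); assert (0 <= INR n * (e * e)) by (apply Rmult_le_pos; nra); lra.
Qed.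

(** The properties of p = z f' / f that enter the bound on its coefficients;
    subordination is reduced to the range of the values. *)
Definition hpl_valued (s : R) (p : C -> C) : Prop :=
  regular p /\ tends0 p 1 /\
  forall z, punctured z -> exists w, unit_disk w /\ p z = q_hpl s w.

(** Integrate [kernel_lower_bound] over |z| = r with zeta = conj(c) z^k.  The
    kernel (1 - zeta)^s (1 - r^(2k) / zeta) has the expansion
    - r^(2k) / zeta + (1 + s r^(2k)) + ..., hence picks out the constant term and
    the k-th coefficient of p. *)
Lemma unimodular_coefficient_at_radius (s : R) (p : C -> C) (c : C) (k : nat) (r : R) :
  0 < s <= 1 -> hpl_valued s p ->
  (1 <= k)%nat -> Cmod c = 1 -> 0 < r < 1 ->
  (r ^ k) ^ 2 * (mean r (fun z => c * (/ z) ^ k * p z)%C - s) <= (1 - (r ^ k) ^ 2) / 2.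
Proof.
intros Hs (Hp & Hp0 & Hq) Hk Hc Hr.
assert (Hc0 : c <> RtoC 0) by (apply Cmod_gt_0; lra).
set (tau := r ^ k); set (t2 := tau ^ 2).
set (zeta := fun z => (Cconj c * z ^ k)%C).
assert (Rz : regular zeta) by apply regular_monomial.
assert (Tz : tends0 zeta 0) by now apply tends0_monomial.
assert (Mz : forall z, Cmod (zeta z) = Cmod z ^ k).
{ intros z; unfold zeta; now rewrite Cmod_mult, Cmod_conj, Cmod_pow, Hc, Rmult_1_l. }
assert (Dz : forall z, punctured z -> unit_disk (zeta z)).
{ intros z [Hz1 Hz2]; unfold unit_disk; rewrite Mz; apply pow_lt_1_compat; [lra|lia]. }
assert (Nz : forall z, punctured z -> zeta z <> RtoC 0).
{ intros z [Hz1 Hz2]; apply Cmod_gt_0; rewrite Mz; now apply pow_lt. }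
assert (Iz : forall z, punctured z -> (c * (/ z) ^ k)%C = (/ zeta z)%C).
{ intros z Hz; assert (Hz0 := punctured_neq0 z Hz); unfold zeta.
  rewrite Cpow_inv by exact Hz0.
  assert (Hzk : (z ^ k)%C <> RtoC 0) by now apply Cpow_nz.
  assert (E : (c * Cconj c)%C = RtoC 1).
  { rewrite <- Cmod2_conj, Hc; f_equal; ring. }
  assert (Hcc : Cconj c <> RtoC 0).
  { intros E0; rewrite E0, Cmult_0_r in E; injection E; lra. }
  replace (/ (Cconj c * z ^ k))%C with (RtoC 1 * / (Cconj c * z ^ k))%C by ring.
  rewrite <- E; field; now split. }
set (W := fun z => one_minus_pow s (zeta z)).
assert (RW : regular W) by now apply regular_one_minus_pow.
assert (Ud0 : unit_disk 0) by (unfold unit_disk; rewrite Cmod_0; lra).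
assert (DW := Cderiv_one_minus_pow s 0 Ud0).
assert (TW : tends0 W 1).
{ rewrite <- (one_minus_pow_0 s).
  apply (tends0_comp zeta (one_minus_pow s)); trivial.
  exact (Cderiv_continuous _ _ _ DW). }
(* Splits W p / zeta into p / zeta, whose mean is the coefficient, and V p,
   which tends to - s at the origin. *)
set (V := fun z => ((W z - 1) / zeta z)%C).
assert (RV : regular V).
{ apply (regular_div (fun z => W z - 1)%C zeta); trivial.
  apply (regular_minus W (fun _ => RtoC 1)); trivial; apply regular_const. }
assert (TV : tends0 V (- RtoC s)%C).
{ assert (T := tends0_comp0 zeta _ _ Tz (tends0_slope _ _ DW) Nz).
  rewrite one_minus_pow_0 in T.
  match type of T with tends0 _ ?a => replace (- RtoC s)%C with a; [exact T|] end.
  replace (1 - 0)%C with (RtoC 1) by ring; field; intros E; injection E; lra. }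
set (X := fun z => (c * (/ z) ^ k * p z)%C).
assert (RX : regular X) by (apply (regular_mult (fun z => c * (/ z) ^ k)%C p); trivial; apply regular_inv_monomial).
assert (RWp : regular (fun z => W z * p z)%C) by now apply regular_mult.
assert (RVp : regular (fun z => V z * p z)%C) by now apply regular_mult.
assert (RXV : regular (fun z => X z + V z * p z)%C) by now apply regular_plus.
assert (RtX : regular (fun z => RtoC (- t2) * (X z + V z * p z))%C)
  by (apply (regular_mult (fun _ => RtoC (- t2))); trivial; apply regular_const).
assert (RK : regular (fun z => W z * p z + RtoC (- t2) * (X z + V z * p z))%C)
  by now apply (regular_plus (fun z => W z * p z)%C).
assert (RL : regular (fun z => RtoC ((1 + t2) / 2) - zeta z)%C)
  by (apply (regular_minus (fun _ => RtoC ((1 + t2) / 2)) zeta); trivial; apply regular_const).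
assert (EK : mean r (fun z => W z * p z + RtoC (- t2) * (X z + V z * p z))%C
   = 1 + - t2 * (mean r X + - s)).
{ rewrite (mean_plus (fun z => W z * p z)%C), mean_scal, (mean_plus X (fun z => V z * p z)%C)
    by trivial.
  rewrite (mean_tends0 _ (1 * 1)%C r RWp (tends0_mult _ _ _ _ TW Hp0) Hr).
  rewrite (mean_tends0 _ (- RtoC s * 1)%C r RVp (tends0_mult _ _ _ _ TV Hp0) Hr).
  simpl; ring. }
assert (EL : mean r (fun z => RtoC ((1 + t2) / 2) - zeta z)%C = (1 + t2) / 2).
{ rewrite (mean_tends0 _ (RtoC ((1 + t2) / 2) + - (1) * 0)%C r RL); trivial.
  - simpl; ring.
  - apply tends0_ext with (fun z => RtoC ((1 + t2) / 2) + - (1) * zeta z)%C.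
    { intros z _; ring. }
    apply (tends0_plus (fun _ => RtoC ((1 + t2) / 2)) (fun z => - (1) * zeta z)%C);
      [apply tends0_const|].
    apply (tends0_mult (fun _ => (- (1))%C) zeta); [apply tends0_const|exact Tz]. }
(* On |z| = r, the real part of (1 + r^(2k)) / 2 - zeta is |1 - zeta|^2 / 2. *)
assert (KL := mean_le _ _ r RL RK Hr).
rewrite EK, EL in KL.
assert ((1 + t2) / 2 <= 1 + - t2 * (mean r X + - s)); [apply KL|lra].
intros z Hz.
assert (Hpz : punctured z) by (unfold punctured; lra).
destruct (Hq z Hpz) as (w & Hw & Ew).
assert (KB := kernel_lower_bound s (zeta z) w Hs (Dz z Hpz) Hw).
rewrite <- Ew in KB.
assert (Et : (zeta z * Cconj (zeta z))%C = RtoC t2).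
{ rewrite <- Cmod2_conj, Mz, Hz; reflexivity. }
replace (W z * p z + RtoC (- t2) * (X z + V z * p z))%C
  with (one_minus_pow s (zeta z) * Cconj (1 - zeta z) * p z)%C.
- apply Rle_trans with (2 := KB); apply Req_le.
  assert (E2 : t2 = Re (zeta z) ^ 2 + Im (zeta z) ^ 2).
  { rewrite <- Cmod2_alt, Mz, Hz; reflexivity. }
  rewrite Cmod2_alt, E2; unfold Re, Im; simpl; field.
- unfold X; rewrite (Iz z Hpz), RtoC_opp, <- Et; unfold V; fold (W z).
  replace (Cconj (1 - zeta z)) with (1 - Cconj (zeta z))%C
    by (unfold Cconj, Cminus, Cplus, Copp, RtoC; simpl; f_equal; ring).
  field; auto.
Qed.

(** The previous bound as r tends to 1, the mean being independent of r. *)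
Lemma unimodular_coefficient_le (s : R) (p : C -> C) (c : C) (k : nat) (r : R) :
  0 < s <= 1 -> hpl_valued s p ->
  (1 <= k)%nat -> Cmod c = 1 -> 0 < r < 1 ->
  mean r (fun z => c * (/ z) ^ k * p z)%C <= s.
Proof.
intros Hs Hp Hk Hc Hr; assert (Rp := proj1 Hp).
assert (RX : regular (fun z => c * (/ z) ^ k * p z)%C)
 by (apply (regular_mult (fun z => c * (/ z) ^ k)%C p); trivial; apply regular_inv_monomial).
set (M := mean r _).
destruct (Rle_lt_dec M s) as [h|h]; [exact h|exfalso].
assert (Hk1 : 1 <= INR k) by (change 1 with (INR 1); now apply le_INR).
(* With radius 1 - e, Bernoulli's inequality gives r^(2k) >= (1 + d) / (1 + 2 d),
   while the bound at that radius says r^(2k) <= 1 / (1 + 2 d). *)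
set (d := M - s); set (e := d / (1 + 2 * d) / (2 * INR k)).
assert (Hd : 0 < d) by (unfold d; lra).
assert (Hx : 0 < d / (1 + 2 * d) < 1 / 2).
{ split; [apply Rdiv_lt_0_compat; lra|].
  apply (Rmult_lt_reg_r (1 + 2 * d)); [lra|].
  replace (d / (1 + 2 * d) * (1 + 2 * d)) with d by (field; lra); lra. }
assert (Ee : INR (k * 2) * e = d / (1 + 2 * d)).
{ rewrite mult_INR; unfold e; simpl (INR 2); field; lra. }
assert (He : 0 < e < 1).
{ rewrite mult_INR in Ee; simpl (INR 2) in Ee; split; nra. }
assert (H := unimodular_coefficient_at_radius s p c k (1 - e) Hs Hp Hk Hc ltac:(lra)).
rewrite (mean_radius _ (1 - e) r RX) in H by lra; fold M in H; fold d in H.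
rewrite <- pow_mult in H.
assert (B := bernoulli_lower e (k * 2) ltac:(lra)); rewrite Ee in B.
set (t := (1 - e) ^ (k * 2)) in *.
assert (E1 : (1 - d / (1 + 2 * d)) * (1 + 2 * d) = 1 + d) by (field; lra).
assert ((1 - d / (1 + 2 * d)) * (1 + 2 * d) <= t * (1 + 2 * d)) by (apply Rmult_le_compat_r; lra).
lra.
Qed.

Lemma coefficient_le (s : R) (p : C -> C) (c : C) (k : nat) (r : R) :
  0 < s <= 1 -> hpl_valued s p ->
  (1 <= k)%nat -> 0 < r < 1 ->
  mean r (fun z => c * (/ z) ^ k * p z)%C <= s * Cmod c.
Proof.
intros Hs Hp Hk Hr; assert (Rp := proj1 Hp).
assert (R0 : forall c, regular (fun z => c * (/ z) ^ k * p z)%C)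
 by (intros c0; apply (regular_mult (fun z => c0 * (/ z) ^ k)%C p); trivial; apply regular_inv_monomial).
destruct (Ceq_dec c 0) as [->|n].
- rewrite Cmod_0, Rmult_0_r.
  rewrite (mean_ext _ (fun _ => RtoC 0)); trivial; [rewrite mean_const; simpl; lra| |].
  + apply regular_const.
  + intros z _; f_equal; ring.
- apply Cmod_gt_0 in n.
  set (u := (RtoC (/ Cmod c) * c)%C).
  assert (Hu : Cmod u = 1).
  { unfold u; rewrite Cmod_mult, Cmod_R, Rabs_pos_eq; [field; lra|].
    apply Rlt_le, Rinv_0_lt_compat, n. }
  assert (Ec : c = (RtoC (Cmod c) * u)%C).
  { unfold u; rewrite Cmult_assoc, <- RtoC_mult, Rinv_r by lra; ring. }
  rewrite (mean_ext _ (fun z => RtoC (Cmod c) * (u * (/ z) ^ k * p z))%C r (R0 c)); trivial.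
  + rewrite mean_scal by trivial; rewrite Rmult_comm; apply Rmult_le_compat_r; [lra|].
    now apply unimodular_coefficient_le.
  + apply (regular_mult (fun _ => RtoC (Cmod c))); trivial; apply regular_const.
  + intros z _; f_equal; rewrite Ec at 1; ring.
Qed.

Fixpoint sum_below (u : nat -> R) (n : nat) : R :=
  match n with O => 0 | S m => u O + sum_below (fun k => u (S k)) m end.

Lemma sum_below_last u n : sum_below u (S n) = sum_below u n + u n.
Proof.
revert u; induction n as [|n IH]; intros u; [simpl; ring|].
change (u O + sum_below (fun k => u (S k)) (S n) = u O + sum_below (fun k => u (S k)) n + u (S n)).
rewrite IH; ring.
Qed.

Lemma disk_pseries_0 b h : disk_pseries b h -> h 0 = b O.
Proof.
intros H.
assert (U : unit_disk 0) by (unfold unit_disk; rewrite Cmod_0; lra).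
exact (filterlim_locally_unique (V := C_NormedModule) _ _ _ (H _ U)
  (is_pseries_0 (V := C_NormedModule) b)).
Qed.

Lemma disk_pseries_tends0 b h : disk_pseries b h -> tends0 h (b O).
Proof.
intros H; rewrite <- (disk_pseries_0 b h H); apply tends0_continuous.
destruct (disk_pseries_derive b h H) as [_ D].
apply (Cderiv_continuous _ _ _ (D 0%R ltac:(unfold unit_disk; rewrite Cmod_0; lra))).
Qed.

(** Removing the constant term and dividing by z; this makes the n-th
    coefficient accessible by induction on n. *)
Lemma disk_pseries_shift b h :
  disk_pseries b h ->
  exists h1, disk_pseries (fun n => b (S n)) h1 /\
    forall z, punctured z -> h z = (b O + z * h1 z)%C.
Proof.
intros H.
exists (fun z => if Ceq_dec z 0 then b 1%nat else (/ z * (h z - b O))%C); split.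
- intros z Hz; destruct (Ceq_dec z 0) as [->|n].
  + exact (is_pseries_0 (V := C_NormedModule) (fun n => b (S n))).
  + apply (is_pseries_decr_1 (V := C_NormedModule) b z (/ z)%C (h z)); [|now apply H].
    change (/ z * z = 1)%C; now field.
- intros z Hz; assert (n := punctured_neq0 z Hz).
  destruct (Ceq_dec z 0) as [E|_]; [now destruct n|now field].
Qed.

(** The n-th coefficient of a product h g is the sum over j of b_j times the
    (n-j)-th coefficient of g.  It is stated as an inequality in which the
    coefficients of g of index k >= 1 enter through a bound s; the constant
    term g0 contributes exactly. *)
Lemma mean_disk_pseries_mult_le (s : R) (g : C -> C) (g0 : C) (r : R) :
  regular g -> tends0 g g0 -> 0 < r < 1 ->
  (forall c k, (1 <= k)%nat -> mean r (fun z => c * (/ z) ^ k * g z)%C <= s * Cmod c) ->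
  forall n b h c, disk_pseries b h ->
  mean r (fun z => c * (/ z) ^ n * (h z * g z))%C
    <= s * (Cmod c * sum_below (fun j => Cmod (b j)) n) + Re (c * (b n * g0))%C.
Proof.
intros Hg Hg0 Hr HB; induction n as [|n IH]; intros b h c Hh;
  assert (Rh := proj1 (regular_disk_pseries b h Hh)).
- apply Req_le; simpl (sum_below _ 0); rewrite !Rmult_0_r, Rplus_0_l.
  apply mean_tends0; trivial.
  + apply (regular_mult (fun z => c * (/ z) ^ 0)%C (fun z => h z * g z)%C).
    * apply regular_inv_monomial.
    * now apply regular_mult.
  + apply tends0_ext with (fun z => c * (h z * g z))%C.
    { intros z _; simpl; ring. }
    apply (tends0_mult (fun _ => c)); [apply tends0_const|].
    apply tends0_mult; trivial; now apply disk_pseries_tends0.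
- destruct (disk_pseries_shift b h Hh) as (h1 & Hh1 & E).
  assert (Rh1 := proj1 (regular_disk_pseries _ h1 Hh1)).
  assert (R1 : regular (fun z => c * b O * (/ z) ^ S n * g z)%C).
  { apply (regular_mult (fun z => c * b O * (/ z) ^ S n)%C g); trivial.
    apply regular_inv_monomial. }
  assert (R2 : regular (fun z => c * (/ z) ^ n * (h1 z * g z))%C).
  { apply (regular_mult (fun z => c * (/ z) ^ n)%C (fun z => h1 z * g z)%C).
    - apply regular_inv_monomial.
    - now apply regular_mult. }
  rewrite (mean_ext _ (fun z => c * b O * (/ z) ^ S n * g z + c * (/ z) ^ n * (h1 z * g z))%C).
  + rewrite mean_plus by trivial.
    simpl (sum_below _ (S n)).
    assert (A1 := HB (c * b O)%C (S n) ltac:(lia)).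
    assert (A2 := IH _ h1 c Hh1).
    rewrite Cmod_mult in A1; cbv beta in A2; lra.
  + apply (regular_mult (fun z => c * (/ z) ^ S n)%C (fun z => h z * g z)%C).
    * apply regular_inv_monomial.
    * now apply regular_mult.
  + now apply regular_plus.
  + exact Hr.
  + intros z Hz; assert (Hpz : punctured z) by (unfold punctured; lra).
    assert (n0 := punctured_neq0 z Hpz).
    rewrite (E z Hpz); f_equal; simpl; field; exact n0.
Qed.

(** The product estimate for g = 1, whose coefficients of index k >= 1 vanish,
    applied to - c. *)
Lemma mean_disk_pseries_ge (r : R) (b : nat -> C) (h : C -> C) (c : C) (n : nat) :
  0 < r < 1 -> disk_pseries b h -> Re (c * b n)%C <= mean r (fun z => c * (/ z) ^ n * h z)%C.
Proof.
intros Hr Hh.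
assert (Rh := proj1 (regular_disk_pseries b h Hh)).
assert (H1 : forall c0 k, (1 <= k)%nat ->
  mean r (fun z => c0 * (/ z) ^ k * 1)%C <= 0 * Cmod c0).
{ intros c0 k Hk; rewrite Rmult_0_l; apply Req_le.
  rewrite <- (mean_inv_monomial c0 k r Hk Hr); apply mean_ext; trivial.
  - apply (regular_mult (fun z => c0 * (/ z) ^ k)%C);
      [apply regular_inv_monomial|apply regular_const].
  - apply regular_inv_monomial.
  - intros z _; f_equal; ring. }
assert (H := mean_disk_pseries_mult_le 0 (fun _ => RtoC 1) 1 r (regular_const _) (tends0_const _)
  Hr H1 n b h (- c)%C Hh).
assert (Rc : regular (fun z => c * (/ z) ^ n * h z)%C).
{ apply (regular_mult (fun z => c * (/ z) ^ n)%C h); trivial; apply regular_inv_monomial. }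
rewrite (mean_ext _ (fun z => RtoC (-1) * (c * (/ z) ^ n * h z))%C) in H; trivial.
- rewrite mean_scal in H by trivial.
  replace (Re (- c * (b n * 1))%C) with (- Re (c * b n)%C) in H by (unfold Re; simpl; ring).
  lra.
- apply (regular_mult (fun z => - c * (/ z) ^ n)%C (fun z => h z * 1)%C).
  + apply regular_inv_monomial.
  + apply regular_mult; trivial; apply regular_const.
- apply (regular_mult (fun _ => RtoC (-1))); trivial; apply regular_const.
- intros z _; f_equal.
  replace (RtoC (-1)) with (- (1))%C by (unfold RtoC, Copp; simpl; f_equal; ring); ring.
Qed.

(** The coefficient of z^(n+1) in z f' = p f.  The term a_(n+1) p_0 of the
    product is moved to the left, where (n+1) a_(n+1) becomes n a_(n+1). *)
Lemma ST_hpl_recursion (s : R) (f : C -> C) (a : nat -> C) :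
  0 < s <= 1 -> class_ST_hpl s f -> normalized_expansion a f ->
  forall n, INR n * Cmod (a (S n)) <= s * sum_below (fun j => Cmod (a j)) (S n).
Proof.
intros Hs [(_ & Hu & _) (w & _ & Hw & _ & Hsub)] (Ha0 & Ha1 & Hf).
change (disk_pseries a f) in Hf.
destruct (disk_pseries_derive a f Hf) as [Hf1 Df].
destruct (regular_disk_pseries a f Hf) as [Rf Rf1].
assert (U0 : unit_disk 0) by (unfold unit_disk; rewrite Cmod_0; lra).
assert (F0 : f 0 = RtoC 0) by now rewrite (disk_pseries_0 a f Hf).
assert (F10 : C_derive f 0 = RtoC 1).
{ rewrite (disk_pseries_0 _ _ Hf1); unfold Cderived; rewrite Ha1; simpl; ring. }
assert (Fn : forall z, punctured z -> f z <> RtoC 0).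
{ intros z Hz E; apply (punctured_neq0 z Hz), Hu; trivial; [apply Hz|now rewrite F0]. }
set (p := fun z => (z * C_derive f z / f z)%C).
assert (Rp : regular p).
{ apply (regular_div (fun z => z * C_derive f z)%C f); trivial.
  apply (regular_mult (fun z => z)); trivial; apply regular_id. }
assert (Hp0 : tends0 p 1).
{ assert (T1 := tends0_slope f _ (Df _ U0)).
  assert (T2 := tends0_comp _ Cinv _ T1 ltac:(apply Ccontinuous_inv; rewrite F10; intros E; injection E; lra)).
  assert (T3 := tends0_mult _ _ _ _ (disk_pseries_tends0 _ _ Hf1) T2).
  rewrite <- (disk_pseries_0 _ _ Hf1), F10 in T3.
  replace (RtoC 1) with (1 * / 1)%C at 1 by (field; intros E; injection E; lra).
  apply tends0_ext with (2 := T3).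
  intros z Hz; unfold p; rewrite F0; specialize (Fn z Hz).
  assert (n0 := punctured_neq0 z Hz).
  replace ((f z - 0) / z)%C with (f z / z)%C by (now field).
  field; now split. }
assert (Hq : forall z, punctured z -> exists v, unit_disk v /\ p z = q_hpl s v).
{ intros z Hz; exists (w z); split; [apply Hw, Hz|].
  rewrite <- Hsub by apply Hz; unfold starlike_quotient.
  destruct (Ceq_dec z 0) as [E|_]; [now destruct (punctured_neq0 z Hz)|reflexivity]. }
intros n.
destruct (Ceq_dec (a (S n)) 0) as [E|Hn].
{ rewrite E, Cmod_0, Rmult_0_r; apply Rmult_le_pos; [lra|].
  assert (P : forall m u, (forall j, 0 <= u j) -> 0 <= sum_below u m).
  { clear; induction m as [|m IH]; intros u H; simpl; [lra|].
    apply Rplus_le_le_0_compat; auto. }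
  apply P; intros j; apply Cmod_ge_0. }
apply Cmod_gt_0 in Hn.
(* The unimodular factor that turns a_(n+1) into its modulus. *)
set (c := (RtoC (/ Cmod (a (S n))) * Cconj (a (S n)))%C).
assert (Hc : Cmod c = 1).
{ unfold c; rewrite Cmod_mult, Cmod_R, Cmod_conj, Rabs_pos_eq; [field; lra|].
  apply Rlt_le, Rinv_0_lt_compat, Hn. }
assert (Ec : (c * a (S n))%C = RtoC (Cmod (a (S n)))).
{ unfold c; rewrite <- Cmult_assoc, (Cmult_comm (Cconj _)), <- Cmod2_conj, <- RtoC_mult.
  f_equal; field; lra. }
set (r := 1 / 2); assert (Hr : 0 < r < 1) by (unfold r; lra).
assert (U := mean_disk_pseries_mult_le s p 1 r Rp Hp0 Hr
  (fun c k Hk => coefficient_le s p c k r Hs (conj Rp (conj Hp0 Hq)) Hk Hr) (S n) a f c Hf).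
assert (L := mean_disk_pseries_ge r _ _ c n Hr Hf1).
rewrite (mean_ext _ (fun z => c * (/ z) ^ S n * (f z * p z))%C) in L; trivial.
- unfold Cderived in L.
  replace (c * (INR (S n) * a (S n)))%C with (RtoC (INR (S n)) * (c * a (S n)))%C in L by ring.
  replace (c * (a (S n) * 1))%C with (c * a (S n))%C in U by ring.
  rewrite Ec in U, L; rewrite <- RtoC_mult in L; rewrite Hc, Rmult_1_l in U.
  change (Re (RtoC ?x)) with x in U; change (Re (RtoC ?x)) with x in L.
  rewrite S_INR in L; lra.
- apply (regular_mult (fun z => c * (/ z) ^ n)%C); trivial; apply regular_inv_monomial.
- apply (regular_mult (fun z => c * (/ z) ^ S n)%C (fun z => f z * p z)%C).
  + apply regular_inv_monomial.
  + now apply regular_mult.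
- intros z Hz; assert (Hpz : punctured z) by (unfold punctured; lra).
  assert (n0 := punctured_neq0 z Hpz); specialize (Fn z Hpz).
  f_equal; unfold p; simpl; field; now split.
Qed.

Theorem theorem3p2 :
  forall (s : R) (f : C -> C) (a : nat -> C),
    0 < s <= 1 ->
    class_ST_hpl s f ->
    normalized_expansion a f ->
    forall n : nat, (2 <= n)%nat ->
      Cmod (a n) <= pochhammer s (n - 1) / INR (fact (n - 1)).
Proof.
intros s f a Hs Hf Ha n Hn.
assert (Rec := ST_hpl_recursion s f a Hs Hf Ha).
destruct Ha as (Ha0 & Ha1 & _).
set (beta := fun m => pochhammer s m / INR (fact m)).
assert (Step : forall m, INR (S m) * beta (S m) = (s + INR m) * beta m).
{ intros m; unfold beta; rewrite fact_simpl, mult_INR; simpl pochhammer.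
  field; split; [apply INR_fact_neq_0|apply not_0_INR; lia]. }
(* The second half bounds the right side of the recursion by its value for the
   extremal coefficients beta, which is m beta_m. *)
assert (Main : forall m, Cmod (a (S m)) <= beta m /\
  s * sum_below (fun j => Cmod (a j)) (S m) <= INR m * beta m).
{ induction m as [|m [IH1 IH2]].
  - rewrite Ha1, Cmod_1; simpl; rewrite Ha0, Cmod_0; unfold beta; simpl; split; lra.
  - assert (B : s * sum_below (fun j => Cmod (a j)) (S (S m)) <= INR (S m) * beta (S m)).
    { rewrite sum_below_last, Step.
      assert (s * Cmod (a (S m)) <= s * beta m) by (apply Rmult_le_compat_l; lra); lra. }
    split; [|exact B].
    apply (Rmult_le_reg_l (INR (S m))); [apply lt_0_INR; lia|].
    apply Rle_trans with (2 := B), Rec. }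
destruct n as [|m]; [lia|]; simpl; rewrite Nat.sub_0_r; apply Main.
Qed.
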